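(* Let $\lambda_1,\lambda_2,\mu_1,\mu_2>0$, $\eta_1>0$, $\eta_2=0$, $p\in[0,1]$. For $s>0$ and $j\in\mathbb{N}$, the Laplace transform $B_j(s)=\int_0^{+\infty}e^{-st}b_j(t)\,dt$ of the first-passage-time density $b_j$ is $$B_j(s)=\frac{p}{[\varphi_1(s)]^j}+\frac{1-p}{[\psi_1(s)]^j}+\frac{\eta_1\,p\,\varphi_2(s)}{\lambda_1[\psi_1(s)-\varphi_1(s)]\,[\psi_1(s)-\varphi_2(s)]}\cdot\frac{[\psi_1(s)]^j-[\varphi_1(s)]^j}{[\varphi_1(s)]^{j-1}[\psi_1(s)]^{j-1}},$$ with $$\varphi_1(s),\varphi_2(s)=\frac{s+\lambda_1+\mu_1+\eta_1\pm\sqrt{(s+\lambda_1+\mu_1+\eta_1)^2-4\lambda_1\mu_1}}{2\mu_1},\qquad 0<\varphi_2(s)<1<\varphi_1(s),$$ $$\psi_1(s),\psi_2(s)=\frac{s+\lambda_2+\mu_2\pm\sqrt{(s+\lambda_2+\mu_2)^2-4\lambda_2\mu_2}}{2\mu_2},\qquad 0<\psi_2(s)<1<\psi_1(s).$$ (At values of $s$ with $\psi_1(s)=\varphi_1(s)$, the quotient $\frac{[\psi_1(s)]^j-[\varphi_1(s)]^j}{\psi_1(s)-\varphi_1(s)}$ is understood as its limit value $j[\varphi_1(s)]^{j-1}$.)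
   Context: $\mathbb N=\{1,2,\dots\}$, $\mathbb N_0=\mathbb N\cup\{0\}$. $\{{\bf N}(t)=[N(t),\mathscr{E}(t)],\,t\ge 0\}$ is the continuous-time Markov chain on $\mathbb{N}_0\times\{1,2\}$ with transition rates (case $\eta_2=0$): for $i=1,2$, $(n,i)\to(n+1,i)$ at rate $\lambda_i$ ($n\ge0$), $(n,i)\to(n-1,i)$ at rate $\mu_i$ ($n\ge1$), and $(n,1)\to(n,2)$ at rate $\eta_1$ ($n\ge0$). The initial state is ${\bf N}(0)=(j,1)$ with probability $p$ and $(j,2)$ with probability $1-p$, with $j\in\mathbb{N}$. The first-passage time through zero is $T_j=\inf\{t>0:{\bf N}(t)=(0,1)\text{ or }{\bf N}(t)=(0,2)\}$, with (possibly defective) density $b_j(t)=\frac{d}{dt}\mathbb{P}(T_j<t)$, $t>0$. *)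

(* Defs.v *)
From HB Require Import structures.
From mathcomp Require Import all_boot all_order all_algebra.
From mathcomp Require Import all_classical all_reals all_analysis.

Set Implicit Arguments.
Unset Strict Implicit.
Unset Printing Implicit Defensive.

Import Order.TTheory GRing.Theory Num.Theory.
Import numFieldNormedType.Exports.

Local Open Scope classical_set_scope.
Local Open Scope ring_scope.

(* A state (n, i) is a population size n and an environment i in {1, 2}; the
   environments are encoded as booleans so that [negb] switches them. *)
Definition state : Type := (nat * bool)%type.
Notation env1 := false (only parsing).
Notation env2 := true (only parsing).

Definition rate (R : realType) (lambda mu eta : bool -> R) (x y : state) : R :=
  if y == (x.1.+1, x.2) then lambda x.2
  else if (0 < x.1)%N && (y == (x.1.-1, x.2)) then mu x.2
  else if y == (x.1, ~~ x.2) then eta x.2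
  else 0.

(* The Q-matrix of the off-diagonal rates [q]; from each state only finitely
   many rates are expected to be nonzero, so that the sum is meaningful. *)
Definition q_matrix (R : realType) (q : state -> state -> R) (x y : state) : R :=
  if x == y then - \sum_(z \in [set z | z != x]) q x z else q x y.

Record transition_function (R : realType) (p : R -> state -> state -> R) :
    Prop := {
  tf_ge0 : forall t x y, 0 <= t -> 0 <= p t x y ;
  tf_sum1 : forall t x, 0 <= t ->
    (\esum_(y in [set: state]) (p t x y)%:E = 1)%E ;
  tf_0 : forall x y, p 0 x y = (x == y)%:R ;
  tf_chapman_kolmogorov : forall s t x z, 0 <= s -> 0 <= t ->
    ((p (s + t) x z)%:E = \esum_(y in [set: state]) (p s x y * p t y z)%:E)%E }.

(* Right-continuous, time-homogeneous Markov chain in continuous time with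
   off-diagonal transition rates [q]. Only the times t >= 0 are constrained.
   The Markov property, conditional on any finite history [hist] of
   (time, state) pairs up to time t, is stated in product form so that no
   conditioning on null events occurs. *)
Definition ctmc (R : realType) (d : measure_display) (T : measurableType d)
    (P : probability T R) (q : state -> state -> R)
    (N : R -> {RV P >-> state}) : Prop :=
  (forall w t, 0 <= t -> \forall h \near 0^'+, N (t + h) w = N t w) /\
  exists p : R -> state -> state -> R,
    [/\ transition_function p,
        forall x y,
          (fun h => (p h x y - p 0 x y) / h) @ 0^'+ --> q_matrix q x y &
        forall (hist : seq (R * state)) (t h : R) (x y : state),
          (forall u, u \in hist -> 0 <= u.1 <= t) -> 0 <= t -> 0 <= h ->
          P [set w | (forall u, u \in hist -> N u.1 w = u.2) /\
                     N t w = x /\ N (t + h) w = y] =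
          (P [set w | (forall u, u \in hist -> N u.1 w = u.2) /\
                      N t w = x] * (p h x y)%:E)%E].

Definition first_passage_time (R : realType) (d : measure_display)
    (T : measurableType d) (P : probability T R) (N : R -> {RV P >-> state})
    (w : T) : \bar R :=
  ereal_inf [set t%:E | t in
    [set t : R | 0 < t /\ (N t w = (0%N, env1) \/ N t w = (0%N, env2))]].

Definition fpt_cdf (R : realType) (d : measure_display)
    (T : measurableType d) (P : probability T R) (N : R -> {RV P >-> state})
    (t : R) : R :=
  fine (P [set w | (first_passage_time N w < t%:E)%E]).

Definition fpt_density (R : realType) (d : measure_display)
    (T : measurableType d) (P : probability T R) (N : R -> {RV P >-> state}) :
    R -> R :=
  derive1 (fpt_cdf N).

Definition laplace (R : realType) (b : R -> R) (s : R) : \bar R :=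
  (\int[lebesgue_measure]_(t in `]0%R, +oo[) (expR (- (s * t)) * b t)%:E)%E.

Section Roots.
Context (R : realType) (lambda mu eta : bool -> R).

Definition phi1 (s : R) : R :=
  (s + lambda env1 + mu env1 + eta env1 +
   Num.sqrt ((s + lambda env1 + mu env1 + eta env1) ^+ 2 -
             4 * lambda env1 * mu env1)) / (2 * mu env1).

Definition phi2 (s : R) : R :=
  (s + lambda env1 + mu env1 + eta env1 -
   Num.sqrt ((s + lambda env1 + mu env1 + eta env1) ^+ 2 -
             4 * lambda env1 * mu env1)) / (2 * mu env1).

Definition psi1 (s : R) : R :=
  (s + lambda env2 + mu env2 +
   Num.sqrt ((s + lambda env2 + mu env2) ^+ 2 -
             4 * lambda env2 * mu env2)) / (2 * mu env2).

Definition psi2 (s : R) : R :=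
  (s + lambda env2 + mu env2 -
   Num.sqrt ((s + lambda env2 + mu env2) ^+ 2 -
             4 * lambda env2 * mu env2)) / (2 * mu env2).

End Roots.

(* (x^j - y^j) / (x - y), extended by its limit value at x = y. *)
Definition pow_quotient (R : realType) (j : nat) (x y : R) : R :=
  if x == y then j%:R * y ^+ j.-1 else (x ^+ j - y ^+ j) / (x - y).

(* Main.v *)
Require Import Defs.
From HB Require Import structures.
From mathcomp Require Import all_boot all_order all_algebra.
From mathcomp Require Import all_classical all_reals all_analysis.
From mathcomp Require Import measurable_realfun.
From mathcomp Require Import ring lra.

(** The rates are bounded, so the chain stopped on reaching population 0 has a
    bounded generator A, and its semigroup S_t = exp (t A) is a norm-convergent
    power series.  The proof has two independent halves.

    Probability: the law of the passage time is read off the semigroup,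
    P (T_j < t) = p S_t 1_Z (j, 1) + (1 - p) S_t 1_Z (j, 2), where Z is the set
    of states with population 0 ([hit_before_prob]).  All that is known about
    the transition function p_t is its derivative at 0, state by state.
    Splitting [0, t] into n equal steps and letting n grow turns this into
    uniform lower bounds for p_t (x, y) ([transition_diag_ge],
    [transition_offdiag_ge]).  Along a grid of step h, the Markov property then
    bounds from below both the probability of having visited Z and that of
    having avoided it by iterates of an explicit Euler scheme
    ([markov_visits]).  The two probabilities add up to 1, and so do the
    limits of the two bounds; hence both bounds are sharp as h tends to 0
    ([visits_approx]).  Lower bounds alone suffice, so that no infinite sum
    over states ever has to be estimated.  By right-continuity of the paths,
    dyadic grids detect every visit.

    Analysis: put a = 1 / phi_1 (s), b = 1 / psi_1 (s), and let u be
      u (n, 2) = b ^ n,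
      u (n, 1) = a ^ n + K (a ^ (n - 1) + a ^ (n - 2) b + ... + b ^ (n - 1)),
    with K = eta_1 phi_2 (s) / (lambda_1 (psi_1 (s) - phi_2 (s))).  The
    quadratic equations of a and b give A u = s u off Z, while u = 1 on Z and
    A u = 0 on Z; that is, A u = s u - s 1_Z
    ([kernel_op_passage_transform]).  Consequently
      d/dt [e^(- s t) (S_t 1_Z - S_t u)] = e^(- s t) (d/dt) S_t 1_Z,
    so that the bracket is an antiderivative of the integrand of the Laplace
    transform of the density ([is_derive_discounted]).  As u is bounded, it
    tends to 0 at infinity, and at t = 0 off Z it equals - u.  So the transform
    is p u (j, 1) + (1 - p) u (j, 2), which is the announced formula. *)

Set Implicit Arguments.
Unset Strict Implicit.
Unset Printing Implicit Defensive.

Import Order.TTheory GRing.Theory Num.Theory.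
Import numFieldNormedType.Exports.

Local Open Scope classical_set_scope.
Local Open Scope ring_scope.

(** * Semigroups of bounded weighted kernels *)

Definition bounded_by (R : realType) (X : Type) (M : R) (g : X -> R) :=
  forall x, `|g x| <= M.

Section Kernel.
Context (R : realType) (X : Type) (nb : X -> seq X) (w : X -> X -> R).

Definition kernel_op (f : X -> R) (x : X) : R := \sum_(y <- nb x) w x y * f y.

Lemma kernel_opD a b f g :
  kernel_op (fun x => a * f x + b * g x) =
  (fun x => a * kernel_op f x + b * kernel_op g x).
Proof.
apply/funext => x; rewrite /kernel_op !mulr_sumr -big_split /=.
by apply: eq_bigr => y _; ring.
Qed.

Lemma iter_kernel_opD a b f g k :
  iter k kernel_op (fun x => a * f x + b * g x) =
  (fun x => a * iter k kernel_op f x + b * iter k kernel_op g x).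
Proof. by elim: k => //= k ->; rewrite kernel_opD. Qed.

Context (L : R) (w_ge0 : forall x y, 0 <= w x y)
  (w_sum : forall x, \sum_(y <- nb x) w x y <= L).

Lemma norm_kernel_op f M : bounded_by M f ->
  forall x, `|kernel_op f x| <= L * M.
Proof.
move=> fM x; have M0 : 0 <= M by exact: le_trans (fM x).
apply: (le_trans (ler_norm_sum _ _ _)).
apply: (@le_trans _ _ (\sum_(y <- nb x) w x y * M)).
  by apply: ler_sum => y _; rewrite normrM (ger0_norm (w_ge0 _ _)) ler_wpM2l.
by rewrite -mulr_suml ler_wpM2r.
Qed.

Lemma norm_iter_kernel_op f M k : bounded_by M f ->
  forall x, `|iter k kernel_op f x| <= L ^+ k * M.
Proof.
move=> fM; elim: k => [|k IH] x /=; first by rewrite expr0 mul1r.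
by rewrite exprS -mulrA; exact: norm_kernel_op.
Qed.

Definition semigroup_coef (g : X -> R) (x : X) (k : nat) : R :=
  iter k kernel_op g x / k`!%:R.

(** This is exp (t (J - L)) for the operator J of the kernel.  Writing a
    generator as J - L with J positive makes all terms of the series positive
    for g >= 0 and t >= 0, and the factor exp (- L t) turns the bound L ^ k on
    the k-th power of J into contractivity; the series of exp (t (J - L)) itself
    would only give the bound exp (2 L t). *)
Definition semigroup (t : R) (g : X -> R) (x : X) : R :=
  expR (- (L * t)) * limn (pseries (semigroup_coef g x) t).

Lemma norm_semigroup_coef g M x t k : bounded_by M g ->
  `|semigroup_coef g x k * t ^+ k| <= M * exp_coeff (L * `|t|) k.
Proof.
move=> gM; rewrite /semigroup_coef /exp_coeff /= !normrM normfV normrX.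
rewrite (@ger0_norm _ k`!%:R)// exprMn.
have -> : M * (L ^+ k * `|t| ^+ k / k`!%:R) = (L ^+ k * M) / k`!%:R * `|t| ^+ k.
  by ring.
by rewrite ler_wpM2r ?exprn_ge0// ler_wpM2r// norm_iter_kernel_op.
Qed.

Lemma is_cvg_semigroup_coef g M x t : bounded_by M g ->
  cvgn (pseries (semigroup_coef g x) t).
Proof.
move=> gM; apply: normed_cvg.
apply: (@series_le_cvg _ _ (fun k => M * exp_coeff (L * `|t|) k)) => [n|n|n|].
- exact: normr_ge0.
- by apply: le_trans (norm_semigroup_coef x t n gM).
- exact: norm_semigroup_coef.
- by apply: (@is_cvg_seriesZ _ _ M); exact: is_cvg_series_exp_coeff.
Qed.

Lemma norm_semigroup g M (t : R) x : bounded_by M g -> 0 <= t ->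
  `|semigroup t g x| <= M.
Proof.
move=> gM t0; rewrite /semigroup normrM (ger0_norm (expR_ge0 _)).
have -> : M = expR (- (L * t)) * (M * expR (L * t)).
  by rewrite mulrCA -expRD addNr expR0 mulr1.
rewrite ler_wpM2l ?expR_ge0//.
have cS := is_cvg_semigroup_coef (x := x) (t := t) gM.
apply: ler_cvg_to (cvg_norm cS) (cvgMl_tmp (is_cvg_series_exp_coeff (L * t))) _.
near=> n; rewrite /pseries /series/= mulr_sumr.
apply: le_trans (ler_norm_sum _ _ _) _; apply: ler_sum => k _.
by have := norm_semigroup_coef x t k gM; rewrite (ger0_norm t0).
Unshelve. all: by end_near.
Qed.

Lemma semigroup_linear a b f g Mf Mg t x : bounded_by Mf f -> bounded_by Mg g ->
  semigroup t (fun x => a * f x + b * g x) x =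
  a * semigroup t f x + b * semigroup t g x.
Proof.
move=> fM gM; rewrite /semigroup.
rewrite [RHS](_ : _ = expR (- (L * t)) * (a * limn (pseries (semigroup_coef f x) t)
  + b * limn (pseries (semigroup_coef g x) t))); last by ring.
congr (_ * _); apply: cvg_lim => //.
have -> : pseries (semigroup_coef (fun x => a * f x + b * g x) x) t =
  (fun n => a * pseries (semigroup_coef f x) t n + b * pseries (semigroup_coef g x) t n).
  apply/funext => n; rewrite /pseries /series/= !mulr_sumr -big_split/=.
  by apply: eq_bigr => k _; rewrite /semigroup_coef iter_kernel_opD; ring.
by apply: cvgD; apply: cvgMl_tmp; exact: is_cvg_semigroup_coef.
Qed.

Lemma kernel_op_semigroup g M t : bounded_by M g ->
  kernel_op (semigroup t g) = semigroup t (kernel_op g).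
Proof.
move=> gM; apply/funext => x; rewrite /kernel_op /semigroup.
transitivity (expR (- (L * t)) *
    \sum_(y <- nb x) w x y * limn (pseries (semigroup_coef g y) t)).
  by rewrite mulr_sumr; apply: eq_bigr => y _; rewrite mulrCA.
congr (_ * _); apply/esym/cvg_lim => //.
have -> : pseries (semigroup_coef (kernel_op g) x) t =
  (fun n => \sum_(y <- nb x) w x y * pseries (semigroup_coef g y) t n).
  apply/funext => n; rewrite /pseries /series/=.
  under [RHS]eq_bigr do rewrite mulr_sumr.
  rewrite exchange_big /=; apply: eq_bigr => k _.
  rewrite /semigroup_coef -iterSr /= /kernel_op !mulr_suml.
  by apply: eq_bigr => y _; ring.
elim: (nb x) => [|y s IH].
  by under eq_fun do rewrite big_nil; rewrite big_nil; exact: cvg_cst.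
under eq_fun do rewrite big_cons; rewrite big_cons.
by apply: cvgD => //; apply: cvgMl_tmp; exact: is_cvg_semigroup_coef gM.
Qed.

Lemma semigroup0 g : semigroup 0 g = g.
Proof.
apply/funext => x; rewrite /semigroup mulr0 oppr0 expR0 mul1r.
apply: cvg_lim => //; apply/cvgrPdist_le => e e0; near=> n.
have -> : pseries (semigroup_coef g x) 0 n = g x.
  rewrite /pseries /series/= -[n]prednK; last by near: n; exact: nbhs_infty_gt.
  rewrite big_nat_recl// expr0 /semigroup_coef/= fact0 divr1 mulr1 big1 ?addr0//.
  by move=> i _; rewrite expr0n mulr0.
by rewrite subrr normr0 ltW.
Unshelve. all: by end_near.
Qed.

Lemma pseries_diffs_semigroup_coef g x :
  pseries_diffs (semigroup_coef g x) = semigroup_coef (kernel_op g) x.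
Proof.
apply/funext => k; rewrite /pseries_diffs /semigroup_coef -iterSr factS natrM.
have k1 : k.+1%:R != 0 :> R by rewrite pnatr_eq0.
by rewrite invfM mulrCA mulVKf.
Qed.

Lemma is_derive_semigroup g M (t : R) x : bounded_by M g ->
  is_derive t (1 : R) (fun t : R => semigroup t g x)
    (semigroup t (kernel_op g) x - L * semigroup t g x).
Proof.
move=> gM.
have Jg := norm_kernel_op gM; have JJg := norm_kernel_op Jg.
have dS : is_derive t (1 : R) (fun t : R => limn (pseries (semigroup_coef g x) t))
    (limn (pseries (semigroup_coef (kernel_op g) x) t)).
  rewrite -pseries_diffs_semigroup_coef.
  apply: (@pseries_snd_diffs _ _ (`|t| + 1)).
  - exact: is_cvg_semigroup_coef gM.
  - by rewrite pseries_diffs_semigroup_coef; exact: is_cvg_semigroup_coef Jg.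
  - by rewrite !pseries_diffs_semigroup_coef; exact: is_cvg_semigroup_coef JJg.
  - by rewrite (@ger0_norm _ (_ + _)) ?addr_ge0// ltrDl.
rewrite /semigroup.
apply: is_derive_eq.
rewrite /GRing.scale /=.
ring.
Qed.

End Kernel.

(** Two applications of the mean value theorem; the constant does not depend on
    t, which keeps the error of the Euler scheme uniform in time and state. *)
Lemma taylor_bound (R : realType) (f f1 f2 : R -> R) C t h :
  (forall t, is_derive t (1 : R) f (f1 t)) ->
  (forall t, is_derive t (1 : R) f1 (f2 t)) ->
  (forall t, 0 <= t -> `|f2 t| <= C) -> 0 <= t -> 0 <= h ->
  `|f (t + h) - f t - h * f1 t| <= C * h ^+ 2.
Proof.
move=> df df1 f2C t0 h0.
have C0 : 0 <= C by exact: le_trans (f2C _ t0).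
have cf g g1 : (forall t, is_derive t (1 : R) g (g1 t)) ->
    forall a b : R, {within `[a, b], continuous g}.
  move=> dg a b; apply: derivable_within_continuous => z _.
  by have [] := dg z.
have [||c ctp ->] := @MVT_segment _ f f1 t (t + h).
- by rewrite lerDl.
- exact: cf df _ _.
move: ctp; rewrite in_itv/= => /andP[tc cth].
rewrite (addrC t) addrK mulrC -mulrBr normrM (ger0_norm h0).
have [||c' ctp' ->] := @MVT_segment _ f1 f2 t c.
- by [].
- exact: cf df1 _ _.
move: ctp'; rewrite in_itv/= => /andP[tc' c'c].
rewrite normrM (@ger0_norm _ (c - t)) ?subr_ge0// expr2 (mulrCA C).
rewrite ler_wpM2l// ler_pM ?normr_ge0 ?subr_ge0 ?lerBlDl//.
by rewrite f2C// (le_trans t0).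
Qed.

Section Euler.
Context (R : realType) (X : Type) (nb : X -> seq X) (w : X -> X -> R) (L : R)
  (w_ge0 : forall x y, 0 <= w x y)
  (w_sum : forall x, \sum_(y <- nb x) w x y <= L) (L0 : 0 <= L).
Let J := kernel_op nb w.
Let S := semigroup nb w L.

(** The exact step of the semigroup is exp (- L h) exp (h J).  Replacing both
    factors by their first-order parts separately, rather than expanding the
    product to 1 + h (J - L), gives a positive scheme whose coefficients lie
    below the transition probabilities of the chain. *)
Definition euler_step (h : R) (u : X -> R) (x : X) : R :=
  (1 - L * h) * (u x + h * kernel_op nb w u x).

Lemma euler_step_ge0 h u : 0 <= h -> L * h <= 1 -> (forall x, 0 <= u x) ->
  forall x, 0 <= euler_step h u x.
Proof.
move=> h0 Lh u0 x; rewrite mulr_ge0 ?subr_ge0// addr_ge0// mulr_ge0//.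
by apply: sumr_ge0 => y _; rewrite mulr_ge0.
Qed.

(** Contractivity: the step is positive and maps constants e to at most
    (1 - (L h) ^ 2) e, so a constant error does not grow. *)
Lemma euler_step_lb h u v e : 0 <= h -> L * h <= 1 -> 0 <= e ->
  (forall x, v x - e <= u x) ->
  forall x, euler_step h v x - e <= euler_step h u x.
Proof.
move=> h0 Lh e0 uv x; rewrite /euler_step.
have Lh1 : 0 <= 1 - L * h by rewrite subr_ge0.
have Jvu : kernel_op nb w v x - L * e <= kernel_op nb w u x.
  rewrite lerBlDr -lerBlDl /kernel_op -sumrB.
  apply: (@le_trans _ _ (\sum_(y <- nb x) w x y * e)).
    by apply: ler_sum => y _; rewrite -mulrBr ler_wpM2l// lerBlDl -lerBlDr.
  by rewrite -mulr_suml ler_wpM2r.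
apply: (@le_trans _ _ ((1 - L * h) *
    ((v x - e) + h * (kernel_op nb w v x - L * e)))).
  rewrite -subr_ge0.
  set y := (X in 0 <= X).
  have -> : y = (L * h) ^+ 2 * e by rewrite /y; ring.
  by rewrite mulr_ge0 ?sqr_ge0.
by rewrite ler_wpM2l// lerD// ler_wpM2l.
Qed.

(** Of the constant 5 = 4 + 1, the part 4 L ^ 2 bounds the second time
    derivative (J - L) ^ 2 S_t g, and the part L ^ 2 the cross term
    h ^ 2 L J S_t g of the product defining the step. *)
Lemma euler_step_semigroup g M t h x : bounded_by M g ->
  0 <= t -> 0 <= h ->
  S (t + h) g x - 5 * L ^+ 2 * M * h ^+ 2 <= euler_step h (S t g) x.
Proof.
move=> gM t0 h0.
pose g1 y := 1 * J g y + (- L) * g y.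
pose g2 y := 1 * J g1 y + (- L) * g1 y.
have JgM := norm_kernel_op w_ge0 w_sum gM.
have bnd g' (M' : R) : bounded_by M' g' ->
    bounded_by (2 * L * M') (fun y => 1 * J g' y + (- L) * g' y).
  move=> g'M y; rewrite (le_trans (ler_normD _ _))//.
  rewrite mul1r normrM normrN (ger0_norm L0).
  have := norm_kernel_op w_ge0 w_sum g'M y.
  have := ler_wpM2l L0 (g'M y).
  rewrite -/J; lra.
have g1M := bnd _ _ gM.
have g2M := bnd _ _ g1M.
have dS g' (M' : R) : bounded_by M' g' -> forall t : R,
    is_derive t (1 : R) (fun t : R => S t g' x)
      (S t (fun y => 1 * J g' y + (- L) * g' y) x).
  move=> g'M r.
  rewrite /S (@semigroup_linear _ _ _ _ _ w_ge0 w_sum 1 (- L) _ _ (L * M') M')//.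
    rewrite mul1r mulNr; exact: is_derive_semigroup g'M.
  exact: norm_kernel_op.
have := @taylor_bound _ _ _ _ (2 * L * (2 * L * M)) t h (dS _ _ gM) (dS _ _ g1M).
have SM (r : R) : 0 <= r -> `|S r g2 x| <= 2 * L * (2 * L * M).
  by move=> r0; exact: norm_semigroup g2M r0.
move=> /(_ SM t0 h0).
rewrite /S (@semigroup_linear _ _ _ _ _ w_ge0 w_sum 1 (- L) _ _ (L * M) M)// -/S.
have SJM : `|S t (J g) x| <= L * M by exact: norm_semigroup JgM t0.
rewrite /euler_step (kernel_op_semigroup w_ge0 w_sum t gM) -/S -/J.
set a := S (t + h) g x; set b := S t g x; set c := S t (J g) x.
rewrite ler_norml => /andP[_ H].
have h2 : 0 <= L * h ^+ 2 by rewrite mulr_ge0 ?sqr_ge0.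
have : L * h ^+ 2 * c <= L * h ^+ 2 * (L * M).
  by rewrite ler_wpM2l// (le_trans (ler_norm _)).
nra.
Qed.

Lemma euler_iter_semigroup g M k h x : bounded_by M g ->
  0 <= h -> L * h <= 1 ->
  S (k%:R * h) g x - k%:R * (5 * L ^+ 2 * M * h ^+ 2) <=
  iter k (euler_step h) g x.
Proof.
move=> gM h0 Lh; elim: k x => [|k IH] x /=.
  by rewrite !mul0r subr0 /S semigroup0.
have M0 : 0 <= M by exact: le_trans (gM x).
set C := 5 * L ^+ 2 * M * h ^+ 2 in IH *.
have C0 : 0 <= C by rewrite !mulr_ge0 ?sqr_ge0.
apply: le_trans (euler_step_lb h0 Lh _ IH x); last by rewrite mulr_ge0.
have := @euler_step_semigroup g M (k%:R * h) h x gM _ h0.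
rewrite -/C -nat1r !mulrDl !mul1r (addrC h) => /(_ (mulr_ge0 (ler0n _ _) h0)).
lra.
Qed.

End Euler.

(** With row sums equal to L the operator J - L kills constants: this is
    conservation of probability. *)
Lemma semigroup1 (R : realType) (X : Type) (nb : X -> seq X) (w : X -> X -> R)
    (L t : R) x :
  (forall x, \sum_(y <- nb x) w x y = L) -> semigroup nb w L t (fun=> 1) x = 1.
Proof.
move=> w_sum; rewrite /semigroup.
have JX k : iter k (kernel_op nb w) (fun _ : X => 1 : R) = (fun=> L ^+ k).
  elim: k => [|k IH] /=; first by apply/funext => y; rewrite expr0.
  by rewrite IH; apply/funext => y; rewrite /kernel_op -mulr_suml w_sum exprS.
have -> : pseries (semigroup_coef nb w (fun=> 1) x) t = series (exp_coeff (L * t)).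
  rewrite /pseries; congr (series _); apply/funext => k /=.
  by rewrite /semigroup_coef JX /exp_coeff/= exprMn mulrAC.
by rewrite -/(expR _) -expRD addNr expR0.
Qed.

(** * Lower bounds for transition probabilities *)

Section TransitionBounds.
Context (R : realType) (p : R -> state -> state -> R) (Q : state -> state -> R)
  (L : R) (pP : transition_function p)
  (pQ : forall x y, (fun h => (p h x y - p 0 x y) / h) @ 0^'+ --> Q x y)
  (QL : forall x, - Q x x <= L).

(** All estimates below only use that a path may go through a few chosen
    intermediate states. *)
Lemma chapman_kolmogorov_ge (s t : R) x z (r : seq state) :
  0 <= s -> 0 <= t -> uniq r ->
  \sum_(y <- r) p s x y * p t y z <= p (s + t) x z.
Proof.
move=> s0 t0 r_uniq; rewrite -lee_fin (tf_chapman_kolmogorov pP)//.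
apply: esum_ge; exists [set` r]; first by split => //; exact: finite_seq.
by rewrite -fsbig_seq// sumEFin.
Qed.

Lemma difference_quotient_cvg (t : R) x y : 0 < t ->
  (p (t / n.+1%:R) x y - p 0 x y) / (t / n.+1%:R) @[n --> \oo] --> Q x y.
Proof.
move=> t0; have /cvg_at_rightP := @pQ x y; apply; split.
  by move=> n; rewrite divr_gt0.
rewrite -(mulr0 t); apply: cvgMl_tmp; exact: cvg_harmonic.
Qed.

(** Staying put at the n grid times is one way of returning, so
    p (n h) x x >= p h x x ^ n; this is followed by Bernoulli's inequality. *)
Lemma transition_diag_subdivision (h : R) x n : 0 <= h ->
  1 - n%:R * (1 - p h x x) <= p (n%:R * h) x x.
Proof.
move=> h0; elim: n => [|n IH].
  by rewrite !mul0r subr0 (tf_0 pP) eqxx.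
have := @chapman_kolmogorov_ge (n%:R * h) h x x [:: x] (mulr_ge0 (ler0n _ _) h0) h0 isT.
rewrite big_seq1 -[n.+1%:R]natr1 !mulrDl !mul1r; apply: le_trans.
have := tf_ge0 pP x x h0; set a := p h x x in IH * => a0.
have := ler_wpM2r a0 IH.
have : 0 <= n%:R * (1 - a) ^+ 2 by rewrite mulr_ge0 ?sqr_ge0.
nra.
Qed.

(** Limit of the previous bound for h = t / n: the right-hand derivative at 0
    becomes a bound at every time, uniform in x as soon as Q x x is bounded
    below. *)
Lemma transition_diag_ge (t : R) x : 0 <= t -> 1 + t * Q x x <= p t x x.
Proof.
rewrite le_eqVlt => /predU1P[<-|t0].
  by rewrite mul0r addr0 (tf_0 pP) eqxx.
have cQ : 1 + t * ((p (t / n.+1%:R) x x - p 0 x x) / (t / n.+1%:R))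
    @[n --> \oo] --> 1 + t * Q x x.
  by apply: cvgD; [exact: cvg_cst|apply: cvgMl_tmp; exact: difference_quotient_cvg].
apply: (cvgr_to_le cQ); near=> n.
have n0 : n.+1%:R != 0 :> R by rewrite pnatr_eq0.
have h0 : 0 <= t / n.+1%:R by rewrite divr_ge0// ltW.
have := @transition_diag_subdivision (t / n.+1%:R) x n.+1 h0.
have -> : n.+1%:R * (t / n.+1%:R) = t by rewrite mulrC divfK.
have -> : p 0 x x = 1 by rewrite (tf_0 pP) eqxx.
apply: le_trans; rewrite le_eqVlt; apply/orP; left; apply/eqP.
have t0' : t != 0 by rewrite gt_eqF.
by field; rewrite nat1r n0 t0'.
Unshelve. all: by end_near.
Qed.

Lemma bernoulli_ge (e : R) n : e <= 1 -> 1 - n%:R * e <= (1 - e) ^+ n.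
Proof.
move=> e1; elim: n => [|n IH]; first by rewrite mul0r subr0 expr0.
have e1' : 0 <= 1 - e by rewrite subr_ge0.
have : 0 <= n%:R * e ^+ 2 by rewrite mulr_ge0 ?sqr_ge0.
have := ler_wpM2r e1' IH.
by rewrite [(1 - e) ^+ n.+1]exprSr -[n.+1%:R]natr1; lra.
Qed.

(** One way to go from x to y in n + 1 steps is to wait in x, jump directly to
    y during one of the steps, and wait in y; the n + 1 choices of the jump step
    are disjoint events, each of probability at least
    p h x y * (1 - L h) ^ n. *)
Lemma transition_offdiag_subdivision (h : R) x y n : x != y -> 0 <= h ->
  L * h <= 1 -> n.+1%:R * p h x y * (1 - L * h) ^+ n <= p (n.+1%:R * h) x y.
Proof.
move=> xy h0 Lh.
have b0 : 0 <= 1 - L * h by rewrite subr_ge0.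
have diag z : 1 - L * h <= p h z z.
  apply: le_trans (transition_diag_ge z h0).
  have := ler_wpM2r h0 (QL z); lra.
have diagX z m : (1 - L * h) ^+ m <= p (m%:R * h) z z.
  elim: m => [|m IH]; first by rewrite mul0r (tf_0 pP) eqxx.
  have := @chapman_kolmogorov_ge h (m%:R * h) z z [:: z] h0 (mulr_ge0 (ler0n _ _) h0) isT.
  rewrite big_seq1 -[m.+1%:R]nat1r mulrDl mul1r; apply: le_trans.
  by rewrite exprS ler_pM// exprn_ge0.
elim: n => [|n IH]; first by rewrite expr0 !mul1r mulr1.
have := @chapman_kolmogorov_ge h (n.+1%:R * h) x y [:: x; y] h0 (mulr_ge0 (ler0n _ _) h0).
rewrite /= inE xy => /(_ isT); rewrite big_cons big_seq1 -[n.+2%:R]nat1r mulrDl mul1r.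
have -> : (1 + n.+1%:R) * h = h + n.+1%:R * h by ring.
apply: le_trans.
have pxy := tf_ge0 pP x y h0.
have H1 : (1 - L * h) * (n.+1%:R * p h x y * (1 - L * h) ^+ n) <=
    p h x x * p (n.+1%:R * h) x y.
  by rewrite ler_pM// !mulr_ge0// exprn_ge0.
have H2 := ler_wpM2l pxy (diagX y n.+1).
apply: le_trans (lerD H1 H2).
by rewrite exprS le_eqVlt; apply/orP; left; apply/eqP; ring.
Qed.

Lemma transition_offdiag_ge (t : R) x y : x != y -> 0 <= t -> L * t <= 1 ->
  0 <= L -> t * Q x y * (1 - L * t) <= p t x y.
Proof.
move=> xy; rewrite le_eqVlt => /predU1P[<- _ _|t0 Lt L0].
  by rewrite !mul0r (tf_0 pP) (negbTE xy).
have cQ : t * ((p (t / n.+1%:R) x y - p 0 x y) / (t / n.+1%:R)) * (1 - L * t)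
    @[n --> \oo] --> t * Q x y * (1 - L * t).
  by apply: cvgMr_tmp; apply: cvgMl_tmp; exact: difference_quotient_cvg.
apply: (cvgr_to_le cQ); near=> n.
have n0 : n.+1%:R != 0 :> R by rewrite pnatr_eq0.
have h0 : 0 <= t / n.+1%:R by rewrite divr_ge0// ltW.
set h := t / n.+1%:R in h0 *.
have th : t = n.+1%:R * h by rewrite /h mulrC divfK.
have Lh : L * h <= 1.
  apply: le_trans Lt; rewrite ler_wpM2l// th ler_peMl// ler1n//.
have := @transition_offdiag_subdivision h x y n xy h0 Lh.
rewrite -th; apply: le_trans.
rewrite (tf_0 pP) (negbTE xy) subr0.
have -> : t * (p h x y / h) = n.+1%:R * p h x y.
  have t0' : t != 0 by rewrite gt_eqF.
  rewrite /h.
  by field; rewrite nat1r n0 t0'.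
have pxy := tf_ge0 pP x y h0.
apply: ler_wpM2l; first by rewrite mulr_ge0.
apply: le_trans (bernoulli_ge n Lh).
rewrite lerD2l lerN2 th mulrCA ler_wpM2l// ler_wpM2r//.
by rewrite ler_nat.
Unshelve. all: by end_near.
Qed.

End TransitionBounds.

(** * Visits along a time grid *)

Lemma measurable_state (A : set state) : measurable A.
Proof.
apply: countable_measurable; last exact: countableP.
move=> [n b]; have -> : [set (n, b)] = [set n] `*` [set b].
  by apply/seteqP; split => -[m c] /= [-> ->].
exact: measurableX.
Qed.

Section RealProbability.
Context (R : realType) (d : measure_display) (T : measurableType d)
  (P : probability T R).

Definition pr (A : set T) : R := fine (P A).

Lemma pr_ge0 A : 0 <= pr A.
Proof. by rewrite fine_ge0. Qed.

Lemma le_pr A B : measurable A -> measurable B -> A `<=` B -> pr A <= pr B.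
Proof.
by move=> mA mB AB; rewrite fine_le ?fin_num_measure// le_measure// inE.
Qed.

Lemma prDI A B : measurable A -> measurable B ->
  pr A = pr (A `\` B) + pr (A `&` B).
Proof.
move=> mA mB; rewrite /pr (measureDI P mA mB) fineD// fin_num_measure//.
- exact: measurableD.
- exact: measurableI.
Qed.

Lemma prT : pr setT = 1.
Proof. by rewrite /pr probability_setT. Qed.

Lemma pr_sum_le (X : {RV P >-> state}) (B : set T) (r : seq state) :
  measurable B -> uniq r -> \sum_(y <- r) pr (B `&` (X @^-1` [set y])) <= pr B.
Proof.
elim: r B => [|y r IH] B mB; first by rewrite big_nil pr_ge0.
rewrite /= => /andP[yr r_uniq]; rewrite big_cons.
have mX : measurable (X @^-1` [set y]).
  by apply: measurable_funPTI; exact: measurable_state.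
rewrite (prDI mB mX) addrC lerD2r.
apply: le_trans (IH _ (measurableD mB mX) r_uniq).
rewrite le_eqVlt; apply/orP; left; apply/eqP.
apply: eq_big_seq => z zr; congr pr; apply/seteqP; split => w /=.
  by move=> [Bw Xw]; split => //; split => // Xy; move: yr; rewrite -Xy Xw zr.
by move=> [[Bw _] Xw].
Qed.

End RealProbability.

Section Visits.
Context (R : realType) (T : Type) (N : R -> T -> state) (Z : pred state).

(** Visits to Z at one of the times t, t + h, ..., t + k h.  Time t itself is
    included, so that starting inside Z counts as a visit and Z behaves as an
    absorbing set in the recursion. *)
Fixpoint visits (h : R) (k : nat) (t : R) (w : T) : bool :=
  Z (N t w) || (if k is k'.+1 then visits h k' (t + h) w else false).

Lemma visitsP h k t w :
  reflect (exists2 i, (i <= k)%N & Z (N (t + i%:R * h) w)) (visits h k t w).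
Proof.
apply: (iffP idP).
  elim: k t => [|k IH] t /=.
    by rewrite orbF => Zt; exists 0%N => //; rewrite mul0r addr0.
  case/orP => [Zt|/IH[i ik Zi]]; first by exists 0%N => //; rewrite mul0r addr0.
  by exists i.+1 => //; rewrite -nat1r mulrDl mul1r addrA.
elim: k t => [|k IH] t /= [[|i]] // ik.
- by rewrite mul0r addr0 orbF.
- by rewrite mul0r addr0 => ->.
- rewrite -nat1r mulrDl mul1r addrA => Zi; apply/orP; right; apply: IH.
  by exists i.
Qed.

End Visits.

Section Absorption.
Context (R : realType) (L : R) (Q : state -> state -> R) (Z : pred state)
  (nb : state -> seq state).

(** The chain stopped at Z, in the form J - L: states of Z keep the single
    weight L on themselves, hence a zero generator, and elsewhere L is added to
    the diagonal of Q, which makes it nonnegative. *)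
Definition absorbed_nb x := if Z x then [:: x] else nb x.

Definition absorbed_weight x y : R :=
  (if Z x then 0 else Q x y) + L * (x == y)%:R.

Context (L_ge0 : 0 <= L) (QL : forall x, - Q x x <= L)
  (Q_ge0 : forall x y, x != y -> 0 <= Q x y)
  (nb_uniq : forall x, uniq (nb x)) (nb_self : forall x, x \in nb x)
  (Q_sum : forall x, ~~ Z x -> \sum_(y <- nb x) Q x y = 0).

Lemma absorbed_weight_ge0 x y : 0 <= absorbed_weight x y.
Proof.
rewrite /absorbed_weight; have := QL x; case: (Z x); case: (eqVneq x y) => [xy|xy];
  rewrite ?mulr1 ?mulr0 ?addr0 ?add0r//.
- by rewrite -xy -subr_ge0 opprK addrC.
- by move=> _; exact: Q_ge0.
Qed.

Lemma absorbed_nb_uniq x : uniq (absorbed_nb x).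
Proof. by rewrite /absorbed_nb; case: ifP. Qed.

Lemma absorbed_nb_self x : x \in absorbed_nb x.
Proof. by rewrite /absorbed_nb; case: ifP => //; rewrite inE eqxx. Qed.

Lemma sum_dirac (x : state) (s : seq state) (u : state -> R) :
  uniq s -> x \in s -> \sum_(y <- s) (x == y)%:R * u y = u x.
Proof.
move=> s_uniq xs; rewrite (bigD1_seq x)//= eqxx mul1r big1 ?addr0//.
by move=> y; rewrite eq_sym => /negbTE ->; rewrite mul0r.
Qed.

Lemma absorbed_weight_sum x : \sum_(y <- absorbed_nb x) absorbed_weight x y = L.
Proof.
rewrite big_split/= -mulr_sumr.
under [X in _ + L * X]eq_bigr do rewrite -[_%:R]mulr1.
rewrite (@sum_dirac x _ (fun=> 1)) ?absorbed_nb_uniq ?absorbed_nb_self// mulr1.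
rewrite /absorbed_nb; case: ifP => Zx; first by rewrite big_seq1 add0r.
by rewrite Q_sum ?Zx// add0r.
Qed.

Lemma euler_step_absorbed h u x : Z x ->
  euler_step absorbed_nb absorbed_weight L h u x = (1 - (L * h) ^+ 2) * u x.
Proof.
move=> Zx; rewrite /euler_step /kernel_op /absorbed_nb Zx big_seq1.
by rewrite /absorbed_weight Zx eqxx add0r mulr1; ring.
Qed.

Lemma euler_step_sum h u x : ~~ Z x ->
  euler_step absorbed_nb absorbed_weight L h u x =
  \sum_(y <- nb x) (1 - L * h) * ((x == y)%:R + h * absorbed_weight x y) * u y.
Proof.
move=> Zx; rewrite /euler_step /kernel_op /absorbed_nb (negbTE Zx).
rewrite -[u x](sum_dirac u (nb_uniq x) (nb_self x)) mulr_sumr -big_split/=.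
by rewrite mulr_sumr; apply: eq_bigr => y _; ring.
Qed.

Context (p : R -> state -> state -> R) (pP : transition_function p)
  (pQ : forall x y, (fun h => (p h x y - p 0 x y) / h) @ 0^'+ --> Q x y).

(** The two bounds on the transition probabilities, summed against u.  On the
    diagonal, (1 - L h) (1 + h (L + Q x x)) differs from 1 + h Q x x by
    - h ^ 2 L (L + Q x x) <= 0. *)
Lemma euler_step_le_transition h u x : ~~ Z x -> 0 <= h -> L * h <= 1 ->
  (forall y, 0 <= u y) ->
  euler_step absorbed_nb absorbed_weight L h u x <=
  \sum_(y <- nb x) p h x y * u y.
Proof.
move=> Zx h0 Lh u0; rewrite euler_step_sum//; apply: ler_sum => y _.
rewrite ler_wpM2r// /absorbed_weight (negbTE Zx).
case: eqVneq => [<-|xy].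
  apply: le_trans (transition_diag_ge pP pQ x h0).
  have Lh0 : 0 <= L * h by rewrite mulr_ge0.
  have := QL x; rewrite -subr_ge0 opprK => LQ.
  have : 0 <= h * (L * h) * (L + Q x x) by rewrite !mulr_ge0.
  rewrite (_ : true%:R = 1 :> R)// mulr1; nra.
rewrite mulr0 addr0 add0r.
apply: le_trans (transition_offdiag_ge pP pQ QL xy h0 Lh L_ge0).
by rewrite mulrC.
Qed.

Let step h := euler_step absorbed_nb absorbed_weight L h.

(** The indicator of Z for b = true and of its complement for b = false, so that
    visiting and avoiding Z can be treated at once. *)
Definition status (b : bool) (x : state) : R := (Z x == b)%:R.

Lemma iter_step_ge0 h k b x : 0 <= h -> L * h <= 1 ->
  0 <= iter k (step h) (status b) x.
Proof.
move=> h0 Lh; elim: k x => [|k IH] x /=; first exact: ler0n.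
exact: (euler_step_ge0 _ absorbed_weight_ge0 h0 Lh IH).
Qed.

Lemma iter_step_le h k b x : 0 <= h -> L * h <= 1 -> Z x ->
  iter k (step h) (status b) x <= status b x.
Proof.
move=> h0 Lh Zx; elim: k => //= k; apply: le_trans.
rewrite /step euler_step_absorbed// ler_piMl ?iter_step_ge0//.
by rewrite gerBl sqr_ge0.
Qed.

Context (d : measure_display) (T : measurableType d) (P : probability T R)
  (N : R -> {RV P >-> state}).

Definition history_event (hist : seq (R * state)) : set T :=
  [set w | forall u, u \in hist -> N u.1 w = u.2].

Lemma history_event_cons t x hist :
  history_event ((t, x) :: hist) = history_event hist `&` (N t @^-1` [set x]).
Proof.
apply/seteqP; split => w /=.
  move=> H; split; last by apply: (H (t, x)); rewrite inE eqxx.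
  by move=> u uh; apply: H; rewrite inE uh orbT.
by move=> [H Nt] u; rewrite inE => /predU1P[->//|]; exact: H.
Qed.

Lemma measurable_RV_preimage t (A : set state) : measurable (N t @^-1` A).
Proof. by apply: measurable_funPTI; exact: measurable_state. Qed.

Lemma measurable_history_event hist : measurable (history_event hist).
Proof.
elim: hist => [|[t x] hist IH].
  rewrite (_ : history_event [::] = setT); first exact: measurableT.
  by apply/seteqP; split.
rewrite history_event_cons; apply: measurableI => //.
exact: measurable_RV_preimage.
Qed.

Lemma measurable_visits h k t b :
  measurable [set w | visits N Z h k t w = b].
Proof.
have -> : [set w | visits N Z h k t w = b] =
    (if b then \bigcup_(i in [set i | (i <= k)%N]) (N (t + i%:R * h) @^-1` [set` Z])
     else ~` \bigcup_(i in [set i | (i <= k)%N]) (N (t + i%:R * h) @^-1` [set` Z])).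
  apply/seteqP; split => w /=; case: b => /=.
  - by move=> /visitsP[i ik Zi]; exists i.
  - by move=> /negP nv [i ik Zi]; apply: nv; apply/visitsP; exists i.
  - by move=> [i ik Zi]; apply/visitsP; exists i.
  - move=> nv; apply/negP => /visitsP[i ik Zi]; apply: nv.
    by exists i.
have mU : measurable (\bigcup_(i in [set i | (i <= k)%N])
    (N (t + i%:R * h) @^-1` [set` Z])).
  by apply: bigcup_measurable => i _; exact: measurable_RV_preimage.
by case: b => //; exact: measurableC.
Qed.

Context (N_markov : forall (hist : seq (R * state)) (t h : R) (x y : state),
  (forall u, u \in hist -> 0 <= u.1 <= t) -> 0 <= t -> 0 <= h ->
  P [set w | (forall u, u \in hist -> N u.1 w = u.2) /\
     N t w = x /\ N (t + h) w = y] =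
  (P [set w | (forall u, u \in hist -> N u.1 w = u.2) /\ N t w = x] *
   (p h x y)%:E)%E).

Lemma markov_pr (hist : seq (R * state)) (t h : R) (x y : state) :
  (forall u, u \in hist -> 0 <= u.1 <= t) -> 0 <= t -> 0 <= h ->
  pr P (history_event ((t + h, y) :: (t, x) :: hist)) =
  pr P (history_event ((t, x) :: hist)) * p h x y.
Proof.
move=> ht t0 h0; rewrite !history_event_cons -setIA.
rewrite /pr [X in fine X](N_markov x y ht t0 h0) fineM//.
rewrite fin_num_measure//.
exact: (measurableI _ _ (measurable_history_event hist)
  (measurable_RV_preimage t [set x])).
Qed.

(** Induction on the number k of steps, with the past generalized: after one
    step the current state joins the history, and the Markov property given a
    finite history is exactly what is assumed of the chain.  Restricting the
    state at time t + h to the finitely many neighbours of x only loses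
    probability. *)
Lemma markov_visits (h : R) b k (hist : seq (R * state)) (t : R) (x : state) :
  0 <= h -> L * h <= 1 -> 0 <= t ->
  (forall u, u \in hist -> 0 <= u.1 <= t) ->
  pr P (history_event ((t, x) :: hist)) * iter k (step h) (status b) x <=
  pr P (history_event ((t, x) :: hist) `&` [set w | visits N Z h k t w = b]).
Proof.
move=> h0 Lh; elim: k hist t x => [|k IH] hist t x t0 ht;
  have [Zx|nZx] := boolP (Z x).
all: set E := history_event _.
all: have mE : measurable E by exact: measurable_history_event.
all: have mEv k' t' : measurable (E `&` [set w | visits N Z h k' t' w = b])
  by apply: measurableI => //; exact: measurable_visits.
all: have EN w : E w -> N t w = x by (move=> /(_ (t, x)); apply; rewrite inE eqxx).
- rewrite /= /status Zx; case: eqP => [bE|_]; last by rewrite mulr0 pr_ge0.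
  rewrite mulr1 -bE; rewrite -bE in mEv.
  apply: (le_pr P mE (mEv 0%N t)) => w Ew; split => //=.
  by rewrite orbF (EN _ Ew).
- rewrite /= /status (negbTE nZx); case: eqP => [bE|_]; last by rewrite mulr0 pr_ge0.
  rewrite mulr1 -bE; rewrite -bE in mEv.
  apply: (le_pr P mE (mEv 0%N t)) => w Ew; split => //=.
  by rewrite orbF (EN _ Ew) (negbTE nZx).
- have := @iter_step_le h k.+1 b x h0 Lh Zx; rewrite /status Zx.
  case: eqP => [bE|_] H.
    apply: le_trans (ler_wpM2l (pr_ge0 _ _) H) _.
    rewrite mulr1; apply: (le_pr P mE (mEv k.+1 t)) => w Ew; split => //=.
    by rewrite (EN _ Ew) Zx -bE.
  apply: le_trans (ler_wpM2l (pr_ge0 _ _) H) _.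
  by rewrite mulr0 pr_ge0.
(* Off Z, split according to the state at time t + h. *)
apply: le_trans (pr_sum_le (N (t + h)) (mEv _ _) (nb_uniq x)).
have step_le := @euler_step_le_transition h (iter k (step h) (status b)) x nZx h0 Lh
  (fun y => iter_step_ge0 k b y h0 Lh).
apply: le_trans (ler_wpM2l (pr_ge0 _ _) step_le) _.
rewrite mulr_sumr; apply: ler_sum => y _.
have -> : E `&` [set w | visits N Z h k.+1 t w = b] `&` N (t + h) @^-1` [set y] =
    history_event ((t + h, y) :: (t, x) :: hist) `&`
    [set w | visits N Z h k (t + h) w = b].
  rewrite history_event_cons -/E; apply/seteqP; split => w /=.
    move=> [[Ew +] Nth]; rewrite (EN _ Ew) (negbTE nZx)/= => Hv.
    by split.
  move=> [[Ew Nth] Hv]; split => //; split => //.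
  by rewrite (EN _ Ew) (negbTE nZx).
rewrite mulrA -markov_pr//; apply: IH; first exact: addr_ge0.
move=> u; rewrite inE => /predU1P[->|/ht] /=.
  by rewrite t0 lerDl.
by move=> /andP[-> ut]; rewrite (le_trans ut)// lerDl.
Qed.

Let S := semigroup absorbed_nb absorbed_weight L.

Lemma status_bounded b : bounded_by 1 (status b).
Proof. by move=> x; rewrite /status; case: eqP; rewrite ?normr1 ?normr0. Qed.

Lemma visits_ge (h : R) b k (r : seq state) : 0 <= h -> L * h <= 1 -> uniq r ->
  \sum_(x <- r) pr P (N 0 @^-1` [set x]) = 1 ->
  \sum_(x <- r) pr P (N 0 @^-1` [set x]) * S (k%:R * h) (status b) x
    - k%:R * (5 * L ^+ 2 * h ^+ 2) <=
  pr P [set w | visits N Z h k 0 w = b].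
Proof.
move=> h0 Lh r_uniq r1.
apply: le_trans (pr_sum_le (N 0) (measurable_visits _ _ _ _) r_uniq).
set C := k%:R * (_ * _).
have -> : C = \sum_(x <- r) pr P (N 0 @^-1` [set x]) * C.
  by rewrite -mulr_suml r1 mul1r.
rewrite -sumrB.
apply: ler_sum => x _; rewrite -mulrBr.
have -> : N 0 @^-1` [set x] = history_event [:: (0, x)].
  rewrite history_event_cons; apply/seteqP; split => w /=; first by move=> Nx; split.
  by case.
rewrite setIC.
apply: le_trans (@markov_visits h b k [::] 0 x h0 Lh (lexx 0) _) => //.
rewrite ler_wpM2l ?pr_ge0//.
have := euler_iter_semigroup absorbed_weight_ge0 _ L_ge0 k x (status_bounded b) h0 Lh.
by rewrite mulr1; apply => y; rewrite absorbed_weight_sum.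
Qed.

Lemma semigroup_status_false (t : R) x :
  S t (status false) x = 1 - S t (status true) x.
Proof.
have wS y : \sum_(z <- absorbed_nb y) absorbed_weight y z <= L.
  by rewrite absorbed_weight_sum.
have -> : status false = (fun y => 1 * (fun=> 1) y + (- 1) * status true y).
  by apply/funext => y; rewrite /status; case: (Z y) => /=; ring.
rewrite /S (@semigroup_linear _ _ _ _ _ absorbed_weight_ge0 wS _ _ _ _ 1 1).
- by rewrite semigroup1 ?mul1r ?mulN1r//; exact: absorbed_weight_sum.
- by move=> y; rewrite normr1.
- exact: status_bounded.
Qed.

Context (r : seq state) (r_uniq : uniq r)
  (r1 : \sum_(x <- r) pr P (N 0 @^-1` [set x]) = 1).

(** The probability that the stopped chain is in Z at time t, averaged over the
    initial states in r. *)
Definition absorbed_prob (t : R) : R :=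
  \sum_(x <- r) pr P (N 0 @^-1` [set x]) * S t (status true) x.

(** As S preserves constants, the lower bound for avoiding Z is also the upper
    bound for visiting it: up to the error term, both have the main term
    [absorbed_prob]. *)
Lemma visits_approx (h : R) k : 0 <= h -> L * h <= 1 ->
  `|pr P [set w | visits N Z h k 0 w = true] - absorbed_prob (k%:R * h)| <=
  k%:R * (5 * L ^+ 2 * h ^+ 2).
Proof.
move=> h0 Lh.
have ge1 := visits_ge true k h0 Lh r_uniq r1.
have ge0 := visits_ge false k h0 Lh r_uniq r1.
have E0 : \sum_(x <- r) pr P (N 0 @^-1` [set x]) * S (k%:R * h) (status false) x
    = 1 - absorbed_prob (k%:R * h).
  rewrite -r1 /absorbed_prob -sumrB; apply: eq_bigr => x _.
  by rewrite semigroup_status_false mulrBr mulr1.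
rewrite E0 in ge0.
have V1 : pr P [set w | visits N Z h k 0 w = true] +
    pr P [set w | visits N Z h k 0 w = false] = 1.
  rewrite -(prT P) (prDI P measurableT (measurable_visits h k 0 true)) addrC.
  rewrite setTI setTD; congr (pr P _ + _).
  by apply/seteqP; split => w /=; [move=> ->|move/negP/negbTE].
rewrite -/(absorbed_prob _) in ge1.
rewrite ler_norml; apply/andP; split; lra.
Qed.

Lemma absorbed_prob_continuous (t : R) :
  absorbed_prob u @[u --> t] --> absorbed_prob t.
Proof.
rewrite /absorbed_prob; elim: r => [|x s IH].
  by under eq_fun do rewrite big_nil; rewrite big_nil; exact: cvg_cst.
under eq_fun do rewrite big_cons; rewrite big_cons.
apply: cvgD => //; apply: cvgMl_tmp.
have wS y : \sum_(z <- absorbed_nb y) absorbed_weight y z <= L.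
  by rewrite absorbed_weight_sum.
have [/derivable1_diffP/differentiable_continuous cS _] :=
  is_derive_semigroup absorbed_weight_ge0 wS t x (status_bounded true).
exact: cS.
Qed.

Lemma pr_initial_avoids : (forall x, x \in r -> ~~ Z x) ->
  pr P (N 0 @^-1` [set` Z]) = 0.
Proof.
move=> rZ; have mZ := measurable_RV_preimage 0 [set` Z].
have := pr_sum_le (N 0) (measurableC mZ) r_uniq.
rewrite (eq_big_seq (fun x => pr P (N 0 @^-1` [set x]))); last first.
  move=> x /rZ /negP Zx; congr (pr P _); apply/seteqP; split => w /=; first by case.
  by move=> Nx; split => //; rewrite Nx.
rewrite r1; have := prDI P measurableT mZ.
rewrite prT setTD setTI; have := pr_ge0 P (N 0 @^-1` [set` Z]).
move=> H1 H2 H3; apply/eqP; rewrite eq_le H1 andbT; lra.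
Qed.

Context (N_rc : forall w t, 0 <= t -> \forall h \near 0^'+, N (t + h) w = N t w).

(** The grid has 2 ^ n points 0, t / 2 ^ n, ..., t - t / 2 ^ n: time t is left
    out because the event to be described is a visit strictly before t. *)
Definition dyadic_visits (t : R) n : set T :=
  [set w | visits N Z (t / (2 ^ n)%:R) (2 ^ n).-1 0 w = true].

Lemma dyadic_visitsP (t : R) n w : 0 < t -> dyadic_visits t n w <->
  exists2 i, (i < 2 ^ n)%N & Z (N (i%:R * (t / (2 ^ n)%:R)) w).
Proof.
move=> t0; split => [/visitsP[i ik]|[i ik Zi]].
  by rewrite add0r => Zi; exists i => //; rewrite -(prednK (expn_gt0 2 n)).
by apply/visitsP; exists i; rewrite ?add0r// -ltnS prednK// expn_gt0.
Qed.

Lemma dyadic_visits_ndecr (t : R) : 0 < t ->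
  {homo dyadic_visits t : n m / (n <= m)%N >-> (n <= m)%O}.
Proof.
move=> t0; apply/nondecreasing_seqP => n; rewrite subsetEset => w.
move=> /(dyadic_visitsP _ _ t0)[i ik Zi]; apply/(dyadic_visitsP _ _ t0).
exists (2 * i)%N; first by rewrite expnS ltn_pmul2l.
have -> // : (2 * i)%:R * (t / (2 ^ n.+1)%:R) = i%:R * (t / (2 ^ n)%:R) :> R.
rewrite expnS !natrM invfM.
have n2 : (2 ^ n)%:R != 0 :> R by rewrite pnatr_eq0 -lt0n expn_gt0.
by field.
Qed.

Lemma dyadic_between (t u e : R) : 0 < t -> 0 <= u -> 0 < e -> u + e <= t ->
  exists n i, [/\ (0 < i)%N, (i < 2 ^ n)%N &
    u < i%:R * (t / (2 ^ n)%:R) < u + e].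
Proof.
move=> t0 u0 e0 uet.
(* Any n > t / e makes the mesh smaller than e, since n < 2 ^ n. *)
pose n := (Num.truncn (t / e)).+1.
have n2 : 0 < (2 ^ n)%:R :> R by rewrite ltr0n expn_gt0.
have tn : t / (2 ^ n)%:R < e.
  rewrite ltr_pdivrMr// mulrC -ltr_pdivrMr//.
  apply: (@lt_trans _ _ n%:R); last by rewrite ltr_nat ltn_expl.
  by have /andP[] := truncn_itv (ltW (divr_gt0 t0 e0)).
have h0 : 0 < t / (2 ^ n)%:R by rewrite divr_gt0.
set h := t / (2 ^ n)%:R in tn h0.
have /truncn_itv/andP[i1 i2] : 0 <= u / h by rewrite divr_ge0// ltW.
exists n, (Num.truncn (u / h)).+1.
rewrite ler_pdivlMr// in i1; rewrite ltr_pdivrMr// in i2.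
have i3 : (Num.truncn (u / h)).+1%:R * h < u + e.
  by rewrite -natr1 mulrDl mul1r ler_ltD.
split => //; last by rewrite i2.
rewrite -(ltr_nat R) -(ltr_pM2r h0).
have -> : (2 ^ n)%:R * h = t by rewrite /h mulrC divfK ?gt_eqF.
exact: lt_le_trans uet.
Qed.

(** A path that is in Z at time u stays there for a while, hence is seen by a
    fine enough dyadic grid.  The grid events increase to the union of this
    event and a null event, a start inside Z; their probabilities are computed
    up to an error of order t h by [visits_approx], at time t - h since the last
    grid point is excluded. *)
Lemma hit_before_prob (t : R) : 0 < t -> (forall x, x \in r -> ~~ Z x) ->
  measurable [set w | exists2 u, 0 < u < t & Z (N u w)] /\
  pr P [set w | exists2 u, 0 < u < t & Z (N u w)] = absorbed_prob t.
Proof.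
move=> t0 rZ.
set A := [set w | _].
have AE : A = \bigcup_n \bigcup_(i in [set i | (0 < i < 2 ^ n)%N])
    (N (i%:R * (t / (2 ^ n)%:R)) @^-1` [set` Z]).
  apply/seteqP; split => w.
    move=> [u /andP[u0 ut] Zu].
    have [e /= e0 He] := N_rc w (ltW u0).
    have m0 : 0 < Num.min e (t - u) by rewrite lt_min e0 subr_gt0.
    have [|n [i [i0 ik /andP[ui iu]]]] := dyadic_between t0 (ltW u0) m0.
      by rewrite -lerBrDl ge_min lexx orbT.
    exists n => //; exists i; first by rewrite /= i0.
    have iu' : i%:R * (t / (2 ^ n)%:R) - u < e.
      by rewrite ltrBlDl (lt_le_trans iu)// lerD2l ge_min lexx.
    have := He (i%:R * (t / (2 ^ n)%:R) - u).
    rewrite /= sub0r normrN (addrC u) subrK gtr0_norm ?subr_gt0// => /(_ iu' ui) E.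
    by rewrite E.
  move=> [n _ [i /= /andP[i0 ik] Zi]]; exists (i%:R * (t / (2 ^ n)%:R)) => //.
  have n2 : 0 < (2 ^ n)%:R :> R by rewrite ltr0n expn_gt0.
  apply/andP; split; first by apply: mulr_gt0; [rewrite ltr0n|exact: divr_gt0].
  by rewrite mulrA ltr_pdivrMr// mulrC ltr_pM2l// ltr_nat.
have mA : measurable A.
  rewrite AE; apply: bigcup_measurable => n _; apply: bigcup_measurable => i _.
  exact: measurable_RV_preimage.
split => //.
have mD n : measurable (dyadic_visits t n) by exact: measurable_visits.
pose B := \bigcup_n dyadic_visits t n.
have mB : measurable B by exact: bigcup_measurable.
have BE : B = A `|` (N 0 @^-1` [set` Z]).
  apply/seteqP; split => w.
    move=> [n _ /(dyadic_visitsP _ _ t0)[[|i] ik Zi]].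
      by right; move: Zi; rewrite mul0r.
    by left; rewrite AE; exists n => //; exists i.+1.
  case; last first.
    move=> Z0; exists 0%N => //; apply/(dyadic_visitsP _ _ t0).
    by exists 0%N => //; rewrite mul0r.
  rewrite AE => -[n _ [i /= /andP[i0 ik] Zi]]; exists n => //.
  by apply/(dyadic_visitsP _ _ t0); exists i.
(* The grids contain time 0, but a visit at time 0 has probability 0. *)
have prAB : pr P A = pr P B.
  have mZ := measurable_RV_preimage 0 [set` Z].
  apply/eqP; rewrite eq_le le_pr//=; last by rewrite BE; exact: subsetUl.
  rewrite (prDI P mB mZ) -[leRHS]addr0; apply: lerD.
    apply: le_pr => //; first exact: measurableD.
    by move=> w [+ nZ]; rewrite BE => -[].
  rewrite -[leRHS](pr_initial_avoids rZ).
  exact: (le_pr P (measurableI _ _ mB mZ) mZ (@subIsetr _ _ _)).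
rewrite prAB.
have cB : pr P (dyadic_visits t n) @[n --> \oo] --> pr P B.
  apply: fine_cvg; rewrite fineK ?fin_num_measure//.
  exact: (nondecreasing_cvg_mu mD mB (dyadic_visits_ndecr t0)).
pose h n : R := t / (2 ^ n)%:R.
have h0 n : 0 <= h n by rewrite divr_ge0// ltW.
have kh n : (2 ^ n).-1%:R * h n = t - h n.
  have n2 : (2 ^ n)%:R != 0 :> R by rewrite pnatr_eq0 -lt0n expn_gt0.
  rewrite -subn1 natrB ?expn_gt0// mulrBl mul1r; congr (_ - _).
  by rewrite /h mulrC divfK.
have ch : h n @[n --> \oo] --> (0 : R).
  rewrite -[X in _ --> X](mulr0 t); apply: cvgMl_tmp.
  have -> : (fun n => (2 ^ n)%:R^-1 : R) = (fun n => 2^-1 ^+ n).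
    by apply/funext => n; rewrite natrX exprVn.
  by apply: cvg_expr; rewrite ger0_norm ?invf_lt1// ?ltr1n.
have nL : \forall n \near \oo, L * h n <= 1.
  have cL : L * h n @[n --> \oo] --> (0 : R).
    by rewrite -[X in _ --> X](mulr0 L); exact: cvgMl_tmp.
  exact: (cvgr_le _ cL _ ltr01).
have cG : absorbed_prob (t - h n) @[n --> \oo] --> absorbed_prob t.
  apply: continuous_cvg; first exact: absorbed_prob_continuous.
  by rewrite -[X in _ --> X]subr0; apply: cvgB => //; exact: cvg_cst.
have cE : pr P (dyadic_visits t n) - absorbed_prob (t - h n) @[n --> \oo] --> (0 : R).
  apply/norm_cvg0P; apply: (@squeeze_cvgr _ _ _ _ (fun=> 0)
    (fun n => t * (5 * L ^+ 2) * h n)).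
  - near=> n; rewrite normr_ge0/=.
    have Lh : L * h n <= 1 by near: n; exact: nL.
    have := visits_approx (2 ^ n).-1 (h0 n) Lh; rewrite kh => /le_trans; apply.
    set k := (2 ^ n).-1%:R in kh *.
    have -> : k * (5 * L ^+ 2 * h n ^+ 2) = (k * h n) * (5 * L ^+ 2) * h n by ring.
    rewrite kh ler_wpM2r// ler_wpM2r ?mulr_ge0 ?sqr_ge0//.
    by rewrite gerBl.
  - exact: cvg_cst.
  - by rewrite -[X in _ --> X](mulr0 (t * (5 * L ^+ 2))); exact: cvgMl_tmp.
have cB' : pr P (dyadic_visits t n) @[n --> \oo] --> absorbed_prob t.
  rewrite -[absorbed_prob t]add0r.
  have -> : (fun n => pr P (dyadic_visits t n)) = (fun n =>
      (pr P (dyadic_visits t n) - absorbed_prob (t - h n)) + absorbed_prob (t - h n)).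
    by apply/funext => n; rewrite subrK.
  exact: cvgD.
exact: (cvg_unique _ cB cB').
Unshelve. all: by end_near.
Qed.

End Absorption.

(** * Roots of the characteristic equations *)

Section QuadraticRoots.
Context (R : realType) (l m c : R) (l0 : 0 < l) (m0 : 0 < m) (lmc : l + m < c).
Let D := c ^+ 2 - 4 * l * m.
Let r1 := (c + Num.sqrt D) / (2 * m).
Let r2 := (c - Num.sqrt D) / (2 * m).

(** The polynomial m X ^ 2 - c X + l is negative at 1, which therefore
    separates the roots; both are positive as their product l / m is. *)
Lemma quadratic_roots :
  [/\ m * (r1 + r2) = c, m * (r1 * r2) = l, 1 < r1 & 0 < r2 < 1].
Proof.
have m20 : 0 < 2 * m by rewrite mulr_gt0.
have D0 : 0 < D.
  have -> : D = (c - (l + m)) * (c + (l + m)) + (l - m) ^+ 2 by rewrite /D; ring.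
  rewrite ltr_wpDr ?sqr_ge0// mulr_gt0 ?subr_gt0//.
  by rewrite !addr_gt0// (lt_trans _ lmc)// addr_gt0.
have DE : Num.sqrt D ^+ 2 = D by rewrite sqr_sqrtr// ltW.
have mN0 : m != 0 by rewrite gt_eqF.
have S : m * (r1 + r2) = c by rewrite /r1 /r2; field.
have Pr : m * (r1 * r2) = l.
  have -> : m * (r1 * r2) = (c ^+ 2 - Num.sqrt D ^+ 2) / (4 * m).
    by rewrite /r1 /r2; field.
  by rewrite DE /D; field.
have r1_gt1 : 1 < r1.
  rewrite ltr_pdivlMr// mul1r.
  rewrite -ltrBlDl (le_lt_trans (ler_norm _))// -sqrtr_sqr ltr_sqrt// -subr_gt0.
  (* r1 > 1 amounts to sqrt D > 2 m - c. *)
  have -> : D - (2 * m - c) ^+ 2 = 4 * (m * (c - (l + m))) by rewrite /D; ring.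
  by rewrite mulr_gt0// mulr_gt0// subr_gt0.
have r2_gt0 : 0 < r2.
  have : 0 < m * (r1 * r2) by rewrite Pr.
  by rewrite pmulr_rgt0// pmulr_rgt0// (lt_trans ltr01).
split => //; rewrite r2_gt0/= -subr_gt0.
have : m * ((r1 - 1) * (1 - r2)) > 0.
  have -> : m * ((r1 - 1) * (1 - r2)) = m * (r1 + r2) - m * (r1 * r2) - m by ring.
  by rewrite S Pr; move: lmc; lra.
by rewrite pmulr_rgt0// pmulr_rgt0// subr_gt0.
Qed.

End QuadraticRoots.

(** * The stopped chain in its random environment *)

Section EnvironmentChain.
Context (R : realType) (lambda mu eta : bool -> R)
  (lambda_gt0 : forall i, 0 < lambda i) (mu_gt0 : forall i, 0 < mu i)
  (eta_ge0 : forall i, 0 <= eta i).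

Let Q := q_matrix (rate lambda mu eta).

(** For a positive population, these contain every state with a nonzero entry in
    the row of the generator.  The population 0 is singled out because
    truncated subtraction would list the state itself twice; the stopped chain
    does not leave it anyway. *)
Definition neighbours (x : state) : seq state :=
  if x is (n.+1, i) then [:: (n.+1, i); (n.+2, i); (n, i); (n.+1, ~~ i)]
  else [:: x].

Definition empty_population (x : state) : bool := x.1 == 0%N.

Definition total_rate : R :=
  \sum_(i <- [:: false; true]) (lambda i + mu i + eta i).

Lemma rate_ge0 x y : 0 <= rate lambda mu eta x y.
Proof. by rewrite /rate; do !case: ifP => _ //; exact: ltW. Qed.

Lemma total_rate_ge i : lambda i + mu i + eta i <= total_rate.
Proof.
rewrite /total_rate big_cons big_seq1.
have pos k : 0 <= lambda k + mu k + eta k.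
  by rewrite !addr_ge0// ltW.
by have := pos true; have := pos false; case: i; lra.
Qed.

Lemma q_matrix_offdiag x y : x != y -> Q x y = rate lambda mu eta x y.
Proof. by rewrite /Q /q_matrix => /negbTE ->. Qed.

Lemma rate_up n i : rate lambda mu eta (n, i) (n.+1, i) = lambda i.
Proof. by rewrite /rate eqxx. Qed.

Lemma rate_down n i : rate lambda mu eta (n.+1, i) (n, i) = mu i.
Proof. by rewrite /rate !xpair_eqE !eqxx/= andbT ltn_eqF// ltnW. Qed.

Lemma rate_switch n i : rate lambda mu eta (n, i) (n, ~~ i) = eta i.
Proof.
by rewrite /rate !xpair_eqE !eqxx/= ltn_eqF//=; case: i; rewrite !andbF.
Qed.

Let neq_up n i : (n.+1, i) != (n.+2, i) :> state.
Proof. by rewrite xpair_eqE ltn_eqF. Qed.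
Let neq_down n i : (n.+1, i) != (n, i) :> state.
Proof. by rewrite xpair_eqE gtn_eqF. Qed.
Let neq_switch n i : (n, i) != (n, ~~ i) :> state.
Proof. by rewrite xpair_eqE eqxx/=; case: i. Qed.

Lemma q_matrix_diagS n i :
  Q (n.+1, i) (n.+1, i) = - (lambda i + mu i + eta i).
Proof.
rewrite /Q /q_matrix eqxx; congr (- _).
rewrite (@fsbigE _ _ _ _ _ [:: (n.+2, i); (n, i); (n.+1, ~~ i)]).
- rewrite !big_cons big_nil !mem_set/= ?(eq_sym _ (n.+1, i))//.
  by rewrite rate_up rate_down rate_switch addr0 addrA.
- rewrite /= !inE !xpair_eqE !eqxx !andbT (gtn_eqF (ltnW _))//= eqSS.
  by rewrite (gtn_eqF (leqnn _)) (ltn_eqF (leqnn _)).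
- by move=> z /=; rewrite !inE => /or3P[] /eqP ->; rewrite eq_sym.
- move=> z _; rewrite !inE !negb_or => /and3P[zu zd zs].
  by rewrite /rate (negbTE zu) (negbTE zd) (negbTE zs).
Qed.

Lemma q_matrix_diag0 i : Q (0%N, i) (0%N, i) = - (lambda i + eta i).
Proof.
rewrite /Q /q_matrix eqxx; congr (- _).
rewrite (@fsbigE _ _ _ _ _ [:: (1%N, i); (0%N, ~~ i)]).
- rewrite !big_cons big_nil !mem_set/= ?(eq_sym _ (0%N, i))//.
  by rewrite rate_up rate_switch addr0.
- by [].
- by move=> z /=; rewrite !inE => /orP[] /eqP ->; rewrite eq_sym.
- move=> z _; rewrite !inE !negb_or => /andP[zu zs].
  by rewrite /rate (negbTE zu) (negbTE zs).
Qed.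

Lemma neighbours_uniq x : uniq (neighbours x).
Proof.
case: x => -[|n] i //=; rewrite !inE !xpair_eqE !eqxx/= !andbT !eqSS.
rewrite !(gtn_eqF (leqnn _)) !(ltn_eqF (leqnn _)) (gtn_eqF (ltnW _))//=.
by case: i.
Qed.

Lemma neighbours_self x : x \in neighbours x.
Proof. by case: x => -[|n] i; rewrite /= inE eqxx. Qed.

Lemma q_matrix_opp_diag_le x : - Q x x <= total_rate.
Proof.
case: x => -[|n] i; rewrite ?q_matrix_diag0 ?q_matrix_diagS opprK.
  by apply: le_trans (total_rate_ge i); rewrite lerD2r lerDl ltW.
exact: total_rate_ge.
Qed.

Lemma q_matrix_offdiag_ge0 x y : x != y -> 0 <= Q x y.
Proof. by move=> xy; rewrite q_matrix_offdiag// rate_ge0. Qed.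

Lemma q_matrix_sum_mul n i (f : state -> R) :
  \sum_(y <- neighbours (n.+1, i)) Q (n.+1, i) y * f y =
  lambda i * f (n.+2, i) + mu i * f (n, i) + eta i * f (n.+1, ~~ i)
  - (lambda i + mu i + eta i) * f (n.+1, i).
Proof.
rewrite /neighbours !big_cons big_nil q_matrix_diagS !q_matrix_offdiag//.
by rewrite rate_up rate_down rate_switch; ring.
Qed.

Lemma q_matrix_sum0 x : ~~ empty_population x ->
  \sum_(y <- neighbours x) Q x y = 0.
Proof.
case: x => -[|n] i // _.
transitivity (\sum_(y <- neighbours (n.+1, i)) Q (n.+1, i) y * 1).
  by apply: eq_bigr => y _; rewrite mulr1.
by rewrite (q_matrix_sum_mul n i (fun=> 1)); ring.
Qed.

Let J := kernel_op (absorbed_nb empty_population neighbours)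
  (absorbed_weight total_rate Q empty_population).

Lemma absorbed_kernel_op0 i f : J f (0%N, i) = total_rate * f (0%N, i).
Proof.
by rewrite /J /kernel_op /absorbed_nb /= big_seq1 /absorbed_weight/= eqxx add0r mulr1.
Qed.

Lemma absorbed_kernel_opS n i f : J f (n.+1, i) =
  lambda i * f (n.+2, i) + mu i * f (n, i) + eta i * f (n.+1, ~~ i)
  + (total_rate - (lambda i + mu i + eta i)) * f (n.+1, i).
Proof.
rewrite /J /kernel_op /absorbed_nb /absorbed_weight [empty_population _]/=.
under eq_bigr do rewrite mulrDl -mulrA.
rewrite big_split/= -mulr_sumr sum_dirac ?neighbours_uniq ?neighbours_self//.
  by rewrite q_matrix_sum_mul; ring.
exact: (neighbours_uniq (n.+1, i)).
Qed.

Section Transform.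
Context (s a b K : R) (eta2_eq0 : eta true = 0)
  (a_root : lambda false * a ^+ 2 + mu false =
            (s + lambda false + mu false + eta false) * a)
  (b_root : lambda true * b ^+ 2 + mu true = (s + lambda true + mu true) * b)
  (K_eq : K * (s + lambda false + mu false + eta false - lambda false * (a + b))
          = eta false * b).

(** This is (a ^ n - b ^ n) / (a - b), written so that it also makes sense for
    a = b. *)
Definition mixed_power_sum (n : nat) : R := \sum_(i < n) b ^+ i * a ^+ (n.-1 - i).

Lemma mixed_power_sumS n :
  mixed_power_sum n.+1 = a * mixed_power_sum n + b ^+ n.
Proof.
rewrite /mixed_power_sum big_ord_recr/= subnn expr0 mulr1 mulr_sumr.
congr (_ + _); apply: eq_bigr => -[i /= ilt] _.
case: n ilt => // n ilt; rewrite [n.+1.-1]/= subSn -1?ltnS//.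
by rewrite exprS mulrCA.
Qed.

Definition passage_transform (x : state) : R :=
  if x.2 then b ^+ x.1 else a ^+ x.1 + K * mixed_power_sum x.1.

(** In environment 2 this is the quadratic equation of b.  In environment 1, put
    c_n for the mixed sum: a ^ n + K c_n is a combination of the solution a ^ n
    of the homogeneous recurrence and of c_n, which by
    c_(n+1) = a c_n + b ^ n solves the same recurrence up to a multiple of b ^ n;
    K is the value for which this multiple compensates the switching term
    eta_1 b ^ (n+1). *)
Lemma kernel_op_passage_transform :
  J passage_transform = (fun x => (total_rate + s) * passage_transform x +
                                  (- s) * status R empty_population true x).
Proof.
apply/funext => -[[|n] i].
  rewrite absorbed_kernel_op0 /passage_transform /status /mixed_power_sum/= big_ord0.
  by rewrite expr0; case: i; ring.
rewrite absorbed_kernel_opS /passage_transform /status/= mulr0 addr0.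
case: i => /=.
  rewrite eta2_eq0 !exprS.
  have : b ^+ n * (lambda true * b ^+ 2 + mu true) =
    b ^+ n * ((s + lambda true + mu true) * b) by rewrite b_root.
  rewrite expr2; lra.
rewrite !mixed_power_sumS !exprS.
set c := mixed_power_sum n.
have : (a ^+ n + K * c) * (lambda false * a ^+ 2 + mu false) =
  (a ^+ n + K * c) * ((s + lambda false + mu false + eta false) * a).
  by rewrite a_root.
have : b ^+ n * (K * (s + lambda false + mu false + eta false -
  lambda false * (a + b))) = b ^+ n * (eta false * b) by rewrite K_eq.
rewrite expr2; lra.
Qed.

(** Boundedness is what singles out the roots a, b < 1, and makes the
    discounted term e^(- s t) S_t u vanish at infinity. *)
Lemma passage_transform_bounded : 0 < a < 1 -> 0 < b < 1 ->
  bounded_by (1 + `|K| / (1 - a)) passage_transform.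
Proof.
move=> /andP[a0 a1] /andP[b0 b1].
have a1' : 0 < 1 - a by rewrite subr_gt0.
have mix n : 0 <= mixed_power_sum n <= (1 - a)^-1.
  elim: n => [|n /andP[IH0 IH]].
    by rewrite /mixed_power_sum big_ord0 lexx invr_ge0 ltW.
  rewrite mixed_power_sumS addr_ge0 ?mulr_ge0 ?exprn_ge0 ?(ltW a0) ?(ltW b0)//=.
  have -> : (1 - a)^-1 = a * (1 - a)^-1 + 1 by field; rewrite gt_eqF.
  rewrite lerD// ?ler_wpM2l ?(ltW a0)//.
  by rewrite exprn_ile1// ltW.
have pow_le1 c n : 0 < c -> c < 1 -> `|c ^+ n| <= 1 :> R.
  by move=> c0 c1; rewrite ger0_norm ?exprn_ge0 ?exprn_ile1 ?ltW.
case=> n i; rewrite /passage_transform/=; case: i.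
  apply: le_trans (pow_le1 b n b0 b1) _.
  by rewrite lerDl divr_ge0// ltW.
apply: le_trans (ler_normD _ _) _; rewrite lerD ?pow_le1// normrM ler_wpM2l//.
by have /andP[m0 m1] := mix n; rewrite ger0_norm.
Qed.

End Transform.

End EnvironmentChain.

(** * The Laplace transform of the density *)

Lemma nondecreasing_derivative_ge0 (R : realType) (f : R -> R) (t df : R) :
  0 < t -> is_derive t (1 : R) f df ->
  (forall u v, 0 < u -> u <= v -> f u <= f v) -> 0 <= df.
Proof.
move=> t0 [fd <-] fm.
apply: (cvgr_to_ge fd); near=> h.
have h0 : h != 0 by near: h; exact: nbhs_dnbhs_neq.
have ht : `|h| < t by near: h; exact: dnbhs0_lt.
have th : 0 < h + t.
  by rewrite -ltrBlDr sub0r; move: ht; rewrite ltr_norml => /andP[].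
rewrite /= /GRing.scale/= mulr1.
have [h0'|h0'] := leP 0 h.
  by rewrite mulr_ge0 ?invr_ge0// subr_ge0 fm// lerDr.
rewrite mulr_le0 ?invr_le0 ?(ltW h0')// subr_le0 fm// gerDr ltW//.
Unshelve. all: by end_near.
Qed.

Lemma integral_vanishing_antiderivative (R : realType) (f F : R -> R) :
  (forall t, 0 <= t -> 0 <= f t) -> (forall t, is_derive t (1 : R) F (f t)) ->
  continuous f -> F t @[t --> +oo] --> 0 ->
  (\int[lebesgue_measure]_(t in `]0%R, +oo[) (f t)%:E = (- F 0)%:E)%E.
Proof.
move=> f0 dF cf F0.
rewrite integral_itv_obnd_cbnd; last first.
  apply/measurable_EFinP; apply: measurable_funTS.
  exact: continuous_measurable_fun.
rewrite (@ge0_continuous_FTC2y _ f F 0 0)//.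
- by rewrite -EFinD sub0r.
- exact: continuous_subspaceT.
- have [/derivable1_diffP/differentiable_continuous cF _] := dF 0.
  exact: cvg_at_right_filter.
- by move=> x _; rewrite derive1E; have [_ ->] := dF x.
Qed.

Lemma first_passage_time_ltE (R : realType) (d : measure_display) (T : measurableType d)
    (P : probability T R) (N : R -> {RV P >-> state}) (t : R) :
  [set w | (first_passage_time N w < t%:E)%E] =
  [set w | exists2 u, 0 < u < t & empty_population (N u w)].
Proof.
have emptyP x : empty_population x <-> x = (0%N, env1) \/ x = (0%N, env2).
  split => [|[->|->]] //; case: x => [n []] /eqP /= ->; [by right|by left].
apply/seteqP; split => w /=.
  move=> /ereal_inf_lt [_ [u [u0 /emptyP Nu] <-]]; rewrite lte_fin => ut.
  by exists u => //; rewrite u0.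
move=> [u /andP[u0 ut] /emptyP Nu].
apply: (@le_lt_trans _ _ u%:E); last by rewrite lte_fin.
by apply: ereal_inf_lbound; exists u.
Qed.

(** Here (J - L) u = s (u - g): for the stopped chain with g the indicator of Z,
    such a u is the Laplace transform of the passage time as a function of the
    starting point. *)
Section Discounted.
Context (R : realType) (X : Type) (nb : X -> seq X) (w : X -> X -> R) (L : R)
  (w_ge0 : forall x y, 0 <= w x y)
  (w_sum : forall x, \sum_(y <- nb x) w x y <= L)
  (s M : R) (g u : X -> R) (gM : bounded_by M g) (uM : bounded_by M u)
  (u_eq : kernel_op nb w u = (fun x => (L + s) * u x + (- s) * g x)).
Let S := semigroup nb w L.

(** The semigroup commutes with J, so S_t u has derivative s S_t u - s S_t g, and
    the terms in s cancel against the derivative of the discount factor. *)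
Lemma is_derive_discounted (t : R) x :
  is_derive t (1 : R) (fun t : R => expR (- (s * t)) * (S t g x - S t u x))
    (expR (- (s * t)) * (S t (kernel_op nb w g) x - L * S t g x)).
Proof.
have dg := is_derive_semigroup w_ge0 w_sum t x gM.
have du := is_derive_semigroup w_ge0 w_sum t x uM.
rewrite u_eq (semigroup_linear w_ge0 w_sum _ _ _ _ uM gM) in du.
rewrite -/S in du.
rewrite -/S in dg.
apply: is_derive_eq; rewrite /GRing.scale/=.
ring.
Qed.

Lemma discounted_cvg0 x : 0 < s ->
  expR (- (s * t)) * (S t g x - S t u x) @[t --> +oo] --> 0.
Proof.
move=> s0; apply/norm_cvg0P.
apply: (@squeeze_cvgr _ _ _ _ (fun=> 0) (fun t => expR (- (s * t)) * (M + M))).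
- near=> t; have t0 : 0 <= t by near: t; exact: nbhs_pinfty_ge.
  rewrite normr_ge0 normrM (ger0_norm (expR_ge0 _)) ler_wpM2l ?expR_ge0//.
  rewrite (le_trans (ler_normB _ _))// lerD//.
    exact: norm_semigroup gM t0.
  exact: norm_semigroup uM t0.
- exact: cvg_cst.
- rewrite -[X in _ --> X](mul0r (M + M)); apply: cvgMr_tmp.
  apply: (@cvg_comp _ _ _ (fun t => s * t) (fun t => expR (- t))).
    by apply: gt0_cvgMry => //; exact: cvg_id.
  exact: cvgr_expR.
Unshelve. all: by end_near.
Qed.

End Discounted.

Lemma pow_quotient_mixed_power_sum (R : realType) (j : nat) (x y : R) : (0 < j)%N ->
  x != 0 -> y != 0 ->
  pow_quotient j x y / (y ^+ j.-1 * x ^+ j.-1) = mixed_power_sum y^-1 x^-1 j.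
Proof.
move=> j0 x0 y0.
have -> : pow_quotient j x y = \sum_(i < j) x ^+ (j.-1 - i) * y ^+ i.
  rewrite /pow_quotient; case: eqVneq => [<-|xy].
    under eq_bigr => i _.
      rewrite -exprD subnK; last by rewrite -ltnS prednK.
      over.
    by rewrite sumr_const card_ord mulr_natl.
  by rewrite subrXX mulrC mulKf// subr_eq0.
rewrite /mixed_power_sum mulr_suml; apply: eq_bigr => i _.
have ij : (i <= j.-1)%N by rewrite -ltnS prednK.
rewrite -{2 3}(subnK ij) !exprD !exprVn.
by field; rewrite !expf_neq0.
Qed.

(** With l = m f1 f2 and C = m (f1 + f2), the second factor on the left is
    m f1 (g - f2) / g. *)
Lemma passage_constant_eq (R : realType) (l m C eta f1 f2 g : R) :
  l != 0 -> f1 != 0 -> g != 0 -> g - f2 != 0 -> m * (f1 + f2) = C -> m * (f1 * f2) = l ->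
  (eta * f2 / (l * (g - f2))) * (C - l * (f1^-1 + g^-1)) = eta * g^-1.
Proof.
move=> l0 f10 g0 gf2 <- lE; move: l0; rewrite -lE.
rewrite !mulf_eq0 !negb_or => /and3P[m0 _ f20].
by field; rewrite g0 f10 gf2 f20 m0.
Qed.


Theorem proposition5 (R : realType) (d : measure_display)
    (T : measurableType d) (P : probability T R)
    (lambda mu eta : bool -> R) (p : R) (j : nat)
    (N : R -> {RV P >-> state})
    (lambda_gt0 : forall i, 0 < lambda i) (mu_gt0 : forall i, 0 < mu i)
    (eta1_gt0 : 0 < eta env1) (eta2_eq0 : eta env2 = 0)
    (p01 : 0 <= p <= 1) (j_gt0 : (0 < j)%N)
    (N_ctmc : ctmc (rate lambda mu eta) N)
    (N0_env1 : P [set w | N 0 w = (j, env1)] = p%:E)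
    (N0_env2 : P [set w | N 0 w = (j, env2)] = (1 - p)%:E) :
  (forall t : R, 0 < t -> derivable (fpt_cdf N) t 1) /\
  forall s : R, 0 < s ->
    let f1 := phi1 lambda mu eta s in
    let f2 := phi2 lambda mu eta s in
    let g1 := psi1 lambda mu s in
    let g2 := psi2 lambda mu s in
    [/\ 0 < f2 < 1, 1 < f1, 0 < g2 < 1, 1 < g1 &
        laplace (fpt_density N) s =
        (p / f1 ^+ j + (1 - p) / g1 ^+ j +
         eta env1 * p * f2 / (lambda env1 * (g1 - f2)) *
         (pow_quotient j g1 f1 / (f1 ^+ j.-1 * g1 ^+ j.-1)))%:E].
Proof.
have [N_rc [tr [trP trQ N_markov]]] := N_ctmc.
have eta_ge0 i : 0 <= eta i by case: i; [rewrite eta2_eq0|exact: ltW].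
set Q := q_matrix _ in trQ.
pose L := total_rate lambda mu eta.
have QL x : - Q x x <= L by exact: q_matrix_opp_diag_le.
have Q_ge0 x y : x != y -> 0 <= Q x y by exact: q_matrix_offdiag_ge0.
have Q_sum x : ~~ empty_population x -> \sum_(y <- neighbours x) Q x y = 0.
  exact: q_matrix_sum0.
have L_ge0 : 0 <= L.
  apply: le_trans (total_rate_ge lambda_gt0 mu_gt0 eta_ge0 env1).
  by rewrite !addr_ge0// ltW.
pose nb := absorbed_nb empty_population neighbours.
pose w := absorbed_weight L Q empty_population.
have w_ge0 x y : 0 <= w x y by exact: absorbed_weight_ge0.
have w_sum x : \sum_(y <- nb x) w x y <= L.
  rewrite absorbed_weight_sum//; [exact: neighbours_uniq|exact: neighbours_self].
pose S := semigroup nb w L.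
pose g := status R empty_population true.
pose r : seq state := [:: (j, env1); (j, env2)].
have r_uniq : uniq r by rewrite /= inE xpair_eqE andbF.
have pr1 : pr P (N 0 @^-1` [set (j, env1)]) = p by rewrite /pr [X in fine X]N0_env1.
have pr2 : pr P (N 0 @^-1` [set (j, env2)]) = 1 - p by rewrite /pr [X in fine X]N0_env2.
have r1 : \sum_(x <- r) pr P (N 0 @^-1` [set x]) = 1.
  by rewrite big_cons big_seq1 pr1 pr2 addrC subrK.
have r_pos x : x \in r -> ~~ empty_population x.
  by rewrite !inE => /orP[]/eqP->; rewrite /empty_population/= -lt0n.
pose G (t : R) := p * S t g (j, env1) + (1 - p) * S t g (j, env2).
have hit (t : R) (t0 : 0 < t) := hit_before_prob L_ge0 QL Q_ge0 neighbours_uniq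
  neighbours_self Q_sum trP trQ N_markov r_uniq r1 N_rc t0 r_pos.
have cdfG t : 0 < t -> fpt_cdf N t = G t.
  move=> t0; rewrite /fpt_cdf first_passage_time_ltE -/(pr P _) (hit t t0).2.
  by rewrite /absorbed_prob big_cons big_seq1 pr1 pr2.
have mcdf t : 0 < t -> measurable [set w | (first_passage_time N w < t%:E)%E].
  by move=> t0; rewrite first_passage_time_ltE; exact: (hit t t0).1.
pose dS (t : R) x := S t (kernel_op nb w g) x - L * S t g x.
pose dG (t : R) := p * dS t (j, env1) + (1 - p) * dS t (j, env2).
have gM := status_bounded R empty_population true.
have JgM := norm_kernel_op w_ge0 w_sum gM.
have dGP (t : R) : is_derive t (1 : R) G (dG t).
  have d1 := is_derive_semigroup w_ge0 w_sum t (j, env1) gM.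
  have d2 := is_derive_semigroup w_ge0 w_sum t (j, env2) gM.
  apply: is_derive_eq; rewrite /GRing.scale/= /dG /dS /S/=; ring.
have cdf_deriv (t : R) : 0 < t -> is_derive t (1 : R) (fpt_cdf N) (dG t).
  move=> t0; apply: near_eq_is_derive (dGP t).
  near=> v; rewrite cdfG//; near: v; exact: lt_nbhsr.
split; first by move=> t /cdf_deriv[].
move=> s s0 f1 f2 g1 g2.
have [] := @quadratic_roots R (lambda env1) (mu env1)
  (s + lambda env1 + mu env1 + eta env1) (lambda_gt0 _) (mu_gt0 _).
  by rewrite ltr_wpDr// -addrA ltrDr.
rewrite -/(phi1 lambda mu eta s) -/(phi2 lambda mu eta s) -/f1 -/f2.
move=> f_sum f_prod f1_gt1 f201.
have [] := @quadratic_roots R (lambda env2) (mu env2)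
  (s + lambda env2 + mu env2) (lambda_gt0 _) (mu_gt0 _).
  by rewrite -addrA ltrDr.
rewrite -/(psi1 lambda mu s) -/(psi2 lambda mu s) -/g1 -/g2.
move=> g_sum g_prod g1_gt1 g201.
split=> //.
have /andP[f2_gt0 f2_lt1] := f201; have /andP[g2_gt0 _] := g201.
have f1_gt0 : 0 < f1 by exact: lt_trans f1_gt1.
have g1_gt0 : 0 < g1 by exact: lt_trans g1_gt1.
have f1N0 : f1 != 0 by rewrite gt_eqF.
have g1N0 : g1 != 0 by rewrite gt_eqF.
have gf2 : g1 - f2 != 0 by rewrite subr_eq0 gt_eqF// (lt_trans f2_lt1).
pose K := eta env1 * f2 / (lambda env1 * (g1 - f2)).
have inv01 (z : R) : 1 < z -> 0 < z^-1 < 1.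
  by move=> z1; rewrite invr_gt0 invf_lt1 (lt_trans ltr01)//= z1.
pose u := passage_transform f1^-1 g1^-1 K.
pose M := 1 + `|K| / (1 - f1^-1).
have uM : bounded_by M u by apply: passage_transform_bounded; exact: inv01.
have g_leM : bounded_by M g.
  move=> x; apply: le_trans (gM x) _; rewrite lerDl divr_ge0// subr_ge0 ltW//.
  by have /andP[] := inv01 _ f1_gt1.
have u_eq : kernel_op nb w u = (fun x => (L + s) * u x + (- s) * g x).
  apply: kernel_op_passage_transform => //.
  - rewrite -f_sum -f_prod; field; exact: f1N0.
  - rewrite -g_sum -g_prod; field; exact: g1N0.
  - apply: passage_constant_eq f_sum f_prod => //.
    by rewrite gt_eqF.
(* Minus the expected discount factor of the passages after time t. *)
pose Phi x (t : R) := expR (- (s * t)) * (S t g x - S t u x).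
pose F (t : R) := p * Phi (j, env1) t + (1 - p) * Phi (j, env2) t.
have dF (t : R) : is_derive t (1 : R) F (expR (- (s * t)) * dG t).
  have d1 := is_derive_discounted w_ge0 w_sum g_leM uM u_eq t (j, env1).
  have d2 := is_derive_discounted w_ge0 w_sum g_leM uM u_eq t (j, env2).
  apply: is_derive_eq; rewrite /GRing.scale/= /dG /dS /S/=; ring.
have dG_cont : continuous dG.
  have cS h : bounded_by (L * 1) h \/ bounded_by 1 h ->
    forall x, continuous (fun t : R => S t h x).
    move=> hM x t.
    have [/derivable1_diffP/differentiable_continuous cS _] :
      is_derive t (1 : R) (fun t : R => S t h x) (S t (kernel_op nb w h) x - L * S t h x).
      by case: hM => hM; exact: (is_derive_semigroup w_ge0 w_sum t x hM).
    exact: cS.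
  move=> t; apply: cvgD; apply: cvgMl_tmp; apply: cvgB.
  - by apply: cS; left.
  - by apply: cvgMl_tmp; apply: cS; right.
  - by apply: cS; left.
  - by apply: cvgMl_tmp; apply: cS; right.
have p1 : 0 <= 1 - p by rewrite subr_ge0; case/andP: p01.
have p0 : 0 <= p by case/andP: p01.
have dG_ge0 t : 0 <= t -> 0 <= dG t.
  (* Distribution functions are nondecreasing; at t = 0 the derivative is a flow
     into Z from states outside Z, as S_0 is the identity. *)
  rewrite le_eqVlt => /predU1P[<-|t0]; last first.
    apply: (nondecreasing_derivative_ge0 t0 (cdf_deriv t t0)) => a b a0 ab.
    have b0 : 0 < b by exact: lt_le_trans ab.
    rewrite /fpt_cdf; apply: le_pr; [exact: mcdf|exact: mcdf|].
    by move=> v /= /lt_le_trans; apply; rewrite lee_fin.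
  have dS0 x : x \in r -> 0 <= dS 0 x.
    move=> xr; rewrite /dS /S !semigroup0 /g /status.
    rewrite (negbTE (r_pos x xr)) mulr0 subr0.
    by apply: sumr_ge0 => y _; rewrite mulr_ge0.
  by rewrite /dG addr_ge0// mulr_ge0// dS0// !inE eqxx ?orbT.
rewrite /laplace.
transitivity (\int[lebesgue_measure]_(t in `]0%R, +oo[)
    (expR (- (s * t)) * dG t)%:E)%E.
  apply: eq_integral => t; rewrite inE/= in_itv/= andbT => t0.
  rewrite /fpt_density derive1E.
  by have [_ ->] := cdf_deriv t t0.
rewrite (@integral_vanishing_antiderivative _ _ F)//.
- congr (_%:E); rewrite /F /Phi mulr0 oppr0 expR0 /S !semigroup0 !mul1r.
  rewrite /g /status (negbTE (r_pos (j, env1) _)) ?inE ?eqxx//.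
  rewrite (negbTE (r_pos (j, env2) _)) ?inE ?eqxx ?orbT//.
  rewrite /u /passage_transform/= pow_quotient_mixed_power_sum// /K !exprVn.
  ring.
- by move=> t t0; rewrite mulr_ge0 ?expR_ge0 ?dG_ge0.
- move=> t; apply: cvgM; last exact: dG_cont.
  apply: continuous_comp; last exact: continuous_expR.
  by apply: cvgN; apply: cvgMl_tmp; exact: cvg_id.
- rewrite -[X in _ --> X]addr0 -{1}(mulr0 p) -[X in _ + X](mulr0 (1 - p)).
  by apply: cvgD; apply: cvgMl_tmp; exact: (discounted_cvg0 w_ge0 w_sum g_leM uM _ s0).
Unshelve. all: by end_near.
Qed.
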